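(* Let $A=\mathbb{Z}[u,w]/(u(u+2)(1-uw))$, a Noetherian ring. Then $\mathrm{Spec}(A)$ is connected, and there is a ring homomorphism $MU^{\mathbb{Z}/2}_*\to A$ which sends $u\mapsto u$, whose restriction to $MU_*$ classifies the multiplicative formal group law ($a_{11}\mapsto 1$, $a_{ij}\mapsto 0$ for $i>1$ or $j>1$), and which satisfies $$b_{11}\mapsto 1,\qquad b_{ij}\mapsto 0\ \text{ for } i>1 \text{ or } j>1,\qquad q_k\mapsto -u(u+2)w^k\ \text{ for } k\ge 3$$ (the images of $q_1,q_2$ are then determined). The $\mathbb{Z}/2$-equivariant formal group law over $A$ classified by this homomorphism is not multiplicative, but its underlying non-equivariant formal group law is multiplicative.
   Context: **Cobordism ring.** $MU_*$ is the Lazard ring with universal formal group law $x+_Fy=\sum_{i,j}a_{ij}x^iy^j$, and $[2]x=x+_Fx=\sum_j c_jx^j$. The coefficient ring of $\mathbb{Z}/2$-equivariant stable complex cobordism is (a minor modification of Strickland's presentation) $$MU^{\mathbb{Z}/2}_*=MU_*[u,q_j,b_{ij}\mid i\ge1,j\ge0]/(q_0,\;q_i-c_i-uq_{i+1},\;b_{ij}-a_{ij}-ub_{i,j+1}),$$ and this ring represents $\mathbb{Z}/2$-equivariant formal group laws, so that ring homomorphisms $MU^{\mathbb{Z}/2}_*\to A$ (ignoring gradings) correspond to $\mathbb{Z}/2$-equivariant formal group laws over $A$; $u$ is the Euler class of the nontrivial character $\alpha$. **Equivariant formal group law.** A $\mathbb{Z}/2$-equivariant formal group law over $A$ consists of a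 complete topological commutative Hopf $A$-algebra $B$ (with cocommutative comultiplication $\psi$), a continuous Hopf algebra homomorphism $\theta:B\to A[(\mathbb{Z}/2)^*]^\vee=A\times A$, and a regular element $x\in B$ generating the kernel of the component of $\theta$ at the trivial character, such that the topology of $B$ is defined by the ideal $(x x_\alpha)$, where $x_\alpha$ is the translate of $x$ by $\alpha$ (apply $\psi$ to $x$ and project one coordinate through $\theta$, evaluated at $\alpha$). The Euler class is the value $\theta_\alpha(x)\in A$. Its underlying non-equivariant formal group law is the one over $A$ classified by the composite $MU_*\to MU_*^{\mathbb{Z}/2}\to A$, i.e. obtained by completing $B$ at $(x)$. The equivariant formal group law is multiplicative (in the sense of Cole-Greenlees-Kriz) if $\psi(x)=x\otimes1+1\otimes x+v\,x\otimes x$ for some $v\in A$; here, with $a_{11}\mapsto1$, $v$ would have to be $1$. *)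

(* Defs.v *)
From HB Require Import structures.
From mathcomp Require Import all_boot all_order all_algebra.
From mathcomp Require Import generic_quotient ring_quotient finmap.
From mathcomp Require Import all_classical topology.
From mathcomp.multinomials Require Export monalg.

Set Implicit Arguments.
Unset Strict Implicit.
Unset Printing Implicit Defensive.

Import GRing.Theory.

Local Open Scope classical_set_scope.
Local Open Scope ring_scope.
Local Open Scope quotient_scope.

(* The ideals of ring_quotient are proper, decidable and over a nonzero ring;
   none of this is assumed here. *)
Definition is_ideal (R : comPzRingType) (I : set R) : Prop :=
  [/\ I 0, forall x y, I x -> I y -> I (x + y) & forall a x, I x -> I (a * x)].

Definition ideal_gen (R : comPzRingType) (S : set R) : {pred R} :=
  fun x => `[< forall I : set R, is_ideal I -> S `<=` I -> I x >].

Section RingQuot.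
Variables (R : comPzRingType) (S : set R).

Lemma ideal_genP x : reflect
  (forall I : set R, is_ideal I -> S `<=` I -> I x) (x \in ideal_gen S).
Proof. exact: asboolP. Qed.

Lemma ideal_gen_ideal : is_ideal [set x | x \in ideal_gen S].
Proof.
split=> [|x y /ideal_genP Ix /ideal_genP Iy|a x /ideal_genP Ix];
  apply/ideal_genP => I II SI; have [I0 ID IM] := II => //.
- by apply: ID; [apply: Ix|apply: Iy].
- by apply: IM; apply: Ix.
Qed.

Lemma ideal_gen_zmod : zmod_closed (ideal_gen S).
Proof.
have [I0 ID IM] := ideal_gen_ideal; split=> // x y Ix Iy.
by apply: ID => //; rewrite -mulN1r; apply: IM.
Qed.

HB.instance Definition _ :=
  GRing.isZmodClosed.Build R (ideal_gen S) ideal_gen_zmod.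

Lemma ideal_gen_mul a x : x \in ideal_gen S -> a * x \in ideal_gen S.
Proof. by have [_ _] := ideal_gen_ideal; apply. Qed.

Lemma ideal_gen_sub x : S x -> x \in ideal_gen S.
Proof. by move=> Sx; apply/ideal_genP => I _; apply. Qed.

Definition ringquot := Quotient.quot (ideal_gen S).

HB.instance Definition _ := GRing.Zmodule.on ringquot.

Definition ringquot_pi (x : R) : ringquot := \pi_(Quotient.quot (ideal_gen S)) x.
Let one : ringquot := ringquot_pi 1.
Let mul (x y : ringquot) : ringquot := ringquot_pi (repr x * repr y).

Lemma ringquot_piK (x : ringquot) : ringquot_pi (repr x) = x.
Proof. exact: reprK. Qed.

Lemma ringquot_eq x y :
  (ringquot_pi x = ringquot_pi y) <-> (x - y \in ideal_gen S).
Proof.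
by rewrite Quotient.idealrBE; split=> [/eqP|/eqP].
Qed.

Let pi_mul x y : mul (ringquot_pi x) (ringquot_pi y) = ringquot_pi (x * y).
Proof.
apply/ringquot_eq.
set x' := repr _; set y' := repr _.
have -> : x' * y' - x * y = y' * (x' - x) + x * (y' - y).
  by rewrite !mulrBr addrA [y' * x']mulrC [y' * x]mulrC subrK.
by apply: rpredD; apply: ideal_gen_mul; apply/ringquot_eq/ringquot_piK.
Qed.

Let pi_add x y : ringquot_pi x + ringquot_pi y = ringquot_pi (x + y).
Proof. by rewrite /ringquot_pi raddfD. Qed.

Let mulA : associative mul.
Proof.
move=> x y z; rewrite -[x]ringquot_piK -[y]ringquot_piK -[z]ringquot_piK.
by rewrite !pi_mul mulrA.
Qed.

Let mulC : commutative mul.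
Proof. by move=> x y; rewrite /mul mulrC. Qed.

Let mul1 : left_id one mul.
Proof. by move=> x; rewrite -[x]ringquot_piK pi_mul mul1r. Qed.

Let mulDl : left_distributive mul +%R.
Proof.
move=> x y z; rewrite -[x]ringquot_piK -[y]ringquot_piK -[z]ringquot_piK.
by rewrite pi_add !pi_mul pi_add mulrDl.
Qed.

HB.instance Definition _ :=
  GRing.Zmodule_isComPzRing.Build ringquot mulA mulC mul1 mulDl.

Let pi_zmod : zmod_morphism ringquot_pi.
Proof. by move=> x y; rewrite /ringquot_pi raddfB. Qed.

Let pi_monoid : monoid_morphism ringquot_pi.
Proof. by split=> [//|x y]; rewrite -pi_mul. Qed.

HB.instance Definition _ :=
  GRing.isZmodMorphism.Build R ringquot ringquot_pi pi_zmod.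
HB.instance Definition _ :=
  GRing.isMonoidMorphism.Build R ringquot ringquot_pi pi_monoid.

End RingQuot.

Definition noetherian (R : comPzRingType) : Prop :=
  forall I : set R, is_ideal I -> exists (n : nat) (g : 'I_n -> R),
    I = [set x | exists c : 'I_n -> R, x = \sum_i c i * g i].

Definition is_prime (R : comPzRingType) (P : set R) : Prop :=
  [/\ is_ideal P, ~ P 1 & forall x y, P (x * y) -> P x \/ P y].

Definition Spec (R : comPzRingType) := {P : set R | is_prime P}.

HB.instance Definition _ R := gen_eqMixin (Spec R).
HB.instance Definition _ R := gen_choiceMixin (Spec R).

Section Zariski.
Variable R : comPzRingType.

Definition zariski_closed (E : set R) : set (Spec R) :=
  [set P | E `<=` proj1_sig P].

Definition zariski_open : set (set (Spec R)) :=
  [set U | exists E : set R, U = ~` zariski_closed E].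

Let opT : zariski_open setT.
Proof.
exists [set 1]; rewrite -[LHS]setCK setCT; congr (~` _).
by apply/seteqP; split=> // P PE; have [_ nP1 _] := proj2_sig P; apply/nP1/PE.
Qed.

Let opI : setI_closed zariski_open.
Proof.
move=> _ _ [E ->] [F ->]; rewrite -setCU.
exists [set x | exists2 e, E e & exists2 f, F f & x = e * f]; congr (~` _).
apply/seteqP; split=> [[P PP] /= PEF _ [e Ee [f Ff ->]]|[P PP] /= PEF].
  have [[_ _ PM] _ _] := PP.
  by case: PEF => [/(_ _ Ee)|/(_ _ Ff)] /=; [rewrite mulrC|]; apply: PM.
apply: contrapT => /not_orP[nE nF].
have {nE}[e Ee nPe] : exists2 e, E e & ~ P e.
  by apply: contrapT => h; apply: nE => e Ee; apply: contrapT => ?; apply: h; exists e.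
have {nF}[f Ff nPf] : exists2 f, F f & ~ P f.
  by apply: contrapT => h; apply: nF => f Ff; apply: contrapT => ?; apply: h; exists f.
have [_ _ Pp] := PP.
by have /Pp[] : P (e * f) by apply: PEF; exists e => //; exists f.
Qed.

Let op_bigU (I : Type) (f : I -> set (Spec R)) :
  (forall i, zariski_open (f i)) -> zariski_open (\bigcup_i f i).
Proof.
move=> /choice[E fE]; exists (\bigcup_i E i).
apply/seteqP; split=> P.
  by move=> [i _]; rewrite fE => nP PE; apply: nP => e Ee; apply: PE; exists i.
move=> nP; apply: contrapT => nf; apply: nP => e [i _ Ee].
have : ~ f i P by move=> fP; apply: nf; exists i.
by rewrite fE => /contrapT; apply.
Qed.

HB.instance Definition _ :=
  isOpenTopological.Build (Spec R) opT opI op_bigU.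

End Zariski.

(* The power series \sum_(i, j) F i j x^i y^j. *)
Notation ser2 R := (nat -> nat -> R).

Section FGL.
Variable R : comPzRingType.
Implicit Types F G : ser2 R.

Definition ser2_one : ser2 R := fun i j => ((i == 0) && (j == 0))%:R.
Definition ser2_mul F G : ser2 R := fun m n =>
  \sum_(p < m.+1) \sum_(q < n.+1) F p q * G (m - p)%N (n - q)%N.
Definition ser2_exp F k : ser2 R := iter k (ser2_mul F) ser2_one.

(* The coefficients of x^i y^j z^k in F(F(x, y), z) and in F(x, F(y, z)).  As
   F(0, 0) = 0, the terms left out do not contribute. *)
Definition fgl_assocl F i j k : R :=
  \sum_(p < (i + j).+1) F p k * ser2_exp F p i j.
Definition fgl_assocr F i j k : R :=
  \sum_(p < (j + k).+1) F i p * ser2_exp F p j k.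

Definition is_fgl F : Prop :=
  [/\ forall i, F i 0%N = (i == 1)%:R,
      forall i j, F i j = F j i &
      forall i j k, fgl_assocl F i j k = fgl_assocr F i j k].

(* The coefficients of [2]x = F(x, x). *)
Definition fgl_two F (k : nat) : R := \sum_(i < k.+1) F i (k - i)%N.

(* x + y + v x y *)
Definition mult_law (v : R) : ser2 R := fun i j =>
  match i, j with 1, 0 | 0, 1 => 1 | 1, 1 => v | _, _ => 0 end.

End FGL.

Section FGLMap.
Variables (R S : comPzRingType) (f : {rmorphism R -> S}).
Variables (F : ser2 R) (G : ser2 S).
Hypothesis fF : forall i j, f (F i j) = G i j.

Lemma rmorph_ser2_exp k i j : f (ser2_exp F k i j) = ser2_exp G k i j.
Proof.
elim: k i j => [|k IHk] i j; first by rewrite /= rmorph_nat.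
rewrite /= rmorph_sum; apply: eq_bigr => p _; rewrite rmorph_sum.
by apply: eq_bigr => q _; rewrite rmorphM fF IHk.
Qed.

Lemma rmorph_fgl_assocl i j k : f (fgl_assocl F i j k) = fgl_assocl G i j k.
Proof.
rewrite rmorph_sum; apply: eq_bigr => p _.
by rewrite rmorphM fF rmorph_ser2_exp.
Qed.

Lemma rmorph_fgl_assocr i j k : f (fgl_assocr F i j k) = fgl_assocr G i j k.
Proof.
rewrite rmorph_sum; apply: eq_bigr => p _.
by rewrite rmorphM fF rmorph_ser2_exp.
Qed.

End FGLMap.

Section PolyEval.
Variables (V : choiceType) (R S : comNzRingType) (f : {rmorphism R -> S}).
Variable h : V -> S.

Definition cmonom_eval (m : {cmonom V}) : S :=
  \prod_(v <- finsupp m) h v ^+ m v.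

Lemma cmonom_evalEw (d : {fset V}) (m : {cmonom V}) :
  (finsupp m `<=` d)%fset -> cmonom_eval m = \prod_(v <- d) h v ^+ m v.
Proof.
move=> le; apply: big_fset_incl => // v _.
by rewrite -cmE_eq0 => /eqP->; rewrite expr0.
Qed.

Lemma cmonom_eval_mmorphism : mmorphism cmonom_eval.
Proof.
split=> [m n|]; last by rewrite /cmonom_eval mdom1 big_seq_fset0.
rewrite !(@cmonom_evalEw (finsupp m `|` finsupp n)%fset) ?fsubsetUl ?fsubsetUr //.
  by rewrite -big_split /=; apply: eq_bigr => v _; rewrite cmM exprD.
by rewrite mdomD.
Qed.

HB.instance Definition _ :=
  monalg.isMultiplicative.Build {cmonom V} S cmonom_eval cmonom_eval_mmorphism.

Definition poly_eval : {malg R[{cmonom V}]} -> S := mmap f cmonom_eval.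

HB.instance Definition _ := GRing.RMorphism.on poly_eval.

Lemma poly_evalX v : poly_eval << ucm v >> = h v.
Proof.
rewrite /poly_eval mmapU /= rmorph1 mul1r /cmonom_eval mdomU big_seq_fset1.
by rewrite cmUU expr1.
Qed.

End PolyEval.

Notation lazard_poly := {malg int[{cmonom (nat * nat)%type}]}.

Definition lazard_var (i j : nat) : lazard_poly := << ucm (i, j) >>.

Definition lazard_rel : set lazard_poly :=
  [set r | [\/ exists i, r = lazard_var i 0 - (i == 1)%:R,
               exists i j, r = lazard_var i j - lazard_var j i |
               exists i j k, r = fgl_assocl lazard_var i j k
                                 - fgl_assocr lazard_var i j k]].

Definition MU := ringquot lazard_rel.

HB.instance Definition _ := GRing.ComPzRing.on MU.

Lemma additive_is_fgl (R : comPzRingType) : is_fgl (mult_law (0 : R)).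
Proof.
set F := mult_law _.
have F0 i : F i 0 = (i == 1)%:R by case: i => [|[]].
have F1 i : F i 1 = (i == 0)%:R by case: i => [|[]].
have F2 i k : F i k.+2 = 0 by case: i => [|[]].
have Fs i j : F i j = F j i by case: i j => [|[|i]] [|[|j]].
have e0 i j : ser2_exp F 0 i j = ((i == 0) && (j == 0))%:R by [].
have e1 i j : ser2_exp F 1 i j = F i j.
  rewrite /= /ser2_mul big_ord_recr big1 /= ?add0r => [|[p /= p_lt] _].
    rewrite big_ord_recr big1 /= ?add0r => [|[q /= q_lt] _].
      by rewrite !subnn /ser2_one mulr1.
    by rewrite /ser2_one (subn_eq0 j) leqNgt q_lt andbF mulr0.
  by rewrite big1 // => q _; rewrite /ser2_one (subn_eq0 i) leqNgt p_lt mulr0.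
have sumF k n (G : nat -> R) : (0 < n)%N ->
    \sum_(p < n.+1) F p k * G p = (k == 0)%:R * G 1 + (k == 1)%:R * G 0%N.
  case: n => // n _; rewrite 2!big_ord_recl big1 => [|p _] /=.
    by case: k => [|[|k]]; rewrite ?F0 ?F1 ?F2 /= ?mul0r ?mul1r ?addr0 ?add0r.
  by case: k => [|[|k]]; rewrite ?F0 ?F1 ?F2 /= mul0r.
have asl i j k : fgl_assocl F i j k =
    (k == 0)%:R * F i j + (k == 1)%:R * ((i == 0) && (j == 0))%:R.
  have [/eqP|ij0] := posnP (i + j); last first.
    by rewrite /fgl_assocl (sumF k _ (fun p => ser2_exp F p i j)) // e1 e0.
  rewrite addn_eq0 => /andP[/eqP-> /eqP->].
  rewrite /fgl_assocl big_ord_recl big_ord0 addr0 e0 /= !mulr1.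
  by case: k => [|[|k]]; rewrite ?F0 ?F1 ?F2 /= ?mulr0 ?add0r ?addr0.
have asr i j k : fgl_assocr F i j k =
    (i == 0)%:R * F j k + (i == 1)%:R * ((j == 0) && (k == 0))%:R.
  rewrite -asl /fgl_assocl /fgl_assocr.
  by apply: eq_bigr => p _; rewrite Fs.
split=> // i j k; rewrite asl asr.
by case: i => [|[|i]]; case: j => [|[|j]]; case: k => [|[|k]];
  rewrite /= ?(mul0r, mul1r, mulr0, mulr1, addr0, add0r).
Qed.

Lemma MU_neq0 : (1 : MU) != 0.
Proof.
pose f : {rmorphism lazard_poly -> int} := poly_eval (idfun : {rmorphism int -> int})
            (fun ij : nat * nat => mult_law (0 : int) ij.1 ij.2).
have fX i j : f (lazard_var i j) = mult_law 0 i j by exact: poly_evalX.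
have [H0 HC HA] := additive_is_fgl int.
apply/eqP => one0.
have /ringquot_eq/ideal_genP : ringquot_pi lazard_rel 1 = ringquot_pi _ 0.
  by rewrite rmorph1 rmorph0.
rewrite subr0 => /(_ [set r | f r = 0]) /=.
move=> h; have // : (1 : int) = 0; rewrite -(rmorph1 f); apply: h.
- split=> [|x y|a x] /=; first exact: rmorph0.
  + by move=> fx fy; apply: etrans (rmorphD f x y) _; rewrite /= fx fy.
  + by move=> fx; apply: etrans (rmorphM f a x) _; rewrite /= fx mulr0.
- move=> _ [[i ->]|[i [j ->]]|[i [j [k ->]]]]; apply: etrans (rmorphB f _ _) _.
  + apply/eqP; rewrite subr_eq0; apply/eqP.
    by apply: etrans (fX _ _) (etrans (H0 i) (esym (rmorph_nat f _))).
  + apply/eqP; rewrite subr_eq0; apply/eqP.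
    by apply: etrans (fX _ _) (etrans (HC i j) (esym (fX _ _))).
  + apply/eqP; rewrite subr_eq0; apply/eqP.
    apply: etrans (rmorph_fgl_assocl fX i j k) _.
    by apply: etrans (HA i j k) (esym (rmorph_fgl_assocr fX i j k)).
Qed.

HB.instance Definition _ := GRing.PzSemiRing_isNonZero.Build MU MU_neq0.

(* The coefficients of the universal formal group law, and those of [2]x. *)
Definition MU_a (i j : nat) : MU := ringquot_pi lazard_rel (lazard_var i j).
Definition MU_c (j : nat) : MU := fgl_two MU_a j.

(* [Gb i j] is the generator b_{i + 1, j}. *)
Variant muz2_gen := Gu | Gq of nat | Gb of nat & nat.

HB.instance Definition _ := gen_eqMixin muz2_gen.
HB.instance Definition _ := gen_choiceMixin muz2_gen.

Notation muz2_poly := {malg MU[{cmonom muz2_gen}]}.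

Definition muz2_const (a : MU) : muz2_poly := malgC a.
Definition muz2_u : muz2_poly := << ucm Gu >>.
Definition muz2_q (j : nat) : muz2_poly := << ucm (Gq j) >>.
Definition muz2_b (i j : nat) : muz2_poly := << ucm (Gb i.-1 j) >>.

Definition muz2_rel : set muz2_poly :=
  [set r | [\/ r = muz2_q 0,
               exists i, r = muz2_q i - muz2_const (MU_c i)
                             - muz2_u * muz2_q i.+1 |
               exists i j, (1 <= i)%N /\
                 r = muz2_b i j - muz2_const (MU_a i j)
                     - muz2_u * muz2_b i j.+1]].

Definition MUZ2 := ringquot muz2_rel.

HB.instance Definition _ := GRing.ComPzRing.on MUZ2.

Definition MUZ2_a (i j : nat) : MUZ2 :=
  ringquot_pi muz2_rel (muz2_const (MU_a i j)).
Definition MUZ2_u : MUZ2 := ringquot_pi muz2_rel muz2_u.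
Definition MUZ2_q (j : nat) : MUZ2 := ringquot_pi muz2_rel (muz2_q j).
(* b_{ij}; meaningful for 1 <= i only. *)
Definition MUZ2_b (i j : nat) : MUZ2 := ringquot_pi muz2_rel (muz2_b i j).

(* A commutative A-algebra with a linear topology, given by a fundamental
   system of neighbourhoods of 0 consisting of ideals.  [ct_complete] states
   that it is the limit of its quotients by these ideals, i.e. that it is
   complete and separated. *)
Record ctalg (A : comPzRingType) := CTAlg {
  ct_sort :> comPzRingType;
  ct_unit : {rmorphism A -> ct_sort};
  ct_nbhs : set (set ct_sort);
  ct_ideal : forall I, ct_nbhs I -> is_ideal I;
  ct_nbhs_ex : ct_nbhs !=set0;
  ct_nbhs_dir : forall I J, ct_nbhs I -> ct_nbhs J ->
    exists2 K, ct_nbhs K & K `<=` I `&` J;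
  ct_complete : forall s : set ct_sort -> ct_sort,
    (forall I J, ct_nbhs I -> ct_nbhs J -> I `<=` J -> J (s I - s J)) ->
    exists! l : ct_sort, forall I, ct_nbhs I -> I (l - s I)
}.

Arguments ct_unit {A} _.
Arguments ct_nbhs {A} _ _.

Record cthom (A : comPzRingType) (B C : ctalg A) := CTHom {
  cth_fun :> {rmorphism B -> C};
  cth_unit : forall a, cth_fun (ct_unit B a) = ct_unit C a;
  cth_continuous : forall J, ct_nbhs C J ->
    exists2 I, ct_nbhs B I & forall b, I b -> J (cth_fun b)
}.

Section CTHom.
Variable A : comPzRingType.

Program Definition cth_id (B : ctalg A) : cthom B B :=
  @CTHom _ B B idfun _ _.
Next Obligation. by []. Qed.
Next Obligation. by move=> B J BJ; exists J. Qed.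

Program Definition cth_comp (B C D : ctalg A)
    (g : cthom C D) (f : cthom B C) : cthom B D :=
  @CTHom _ B D (g \o f : {rmorphism B -> D}) _ _.
Next Obligation. by move=> B C D g f a /=; rewrite !cth_unit. Qed.
Next Obligation.
move=> B C D g f J DJ; have [I CI IJ] := cth_continuous g DJ.
by have [H BH HI] := cth_continuous f CI; exists H => // b /HI /IJ.
Qed.

Program Definition ct_disc : ctalg A :=
  @CTAlg A A idfun [set [set 0]] _ _ _ _.
Next Obligation.
by move=> _ ->; split=> [//|x y -> ->|a x ->] /=; rewrite ?addr0 ?mulr0.
Qed.
Next Obligation. by exists [set 0]. Qed.
Next Obligation. by move=> _ _ -> ->; exists [set 0]. Qed.
Next Obligation.
move=> s _; exists (s [set 0]); split=> [_ ->|l ls] /=; first exact: subrr.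
by apply/esym/eqP; rewrite -subr_eq0; apply/eqP/(ls [set 0]).
Qed.

Program Definition ct_eta (B : ctalg A) : cthom ct_disc B :=
  @CTHom _ ct_disc B (ct_unit B) _ _.
Next Obligation. by []. Qed.
Next Obligation.
move=> B J BJ; exists [set 0] => // _ ->; rewrite rmorph0.
by have [] := ct_ideal BJ.
Qed.

End CTHom.

(* A completed tensor product over A of B and C, given by its universal
   property: it is their coproduct among complete topological commutative
   A-algebras, [ctt_in1] and [ctt_in2] being b |-> b (x) 1 and c |-> 1 (x) c,
   and [ctt_copair f g] being b (x) c |-> f(b) g(c). *)
Record cttensor (A : comPzRingType) (B C : ctalg A) := CTTensor {
  ctt_sort :> ctalg A;
  ctt_in1 : cthom B ctt_sort;
  ctt_in2 : cthom C ctt_sort;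
  ctt_copair : forall D : ctalg A, cthom B D -> cthom C D -> cthom ctt_sort D;
  ctt_copair1 : forall (D : ctalg A) (f : cthom B D) (g : cthom C D),
    ctt_copair f g \o ctt_in1 =1 f;
  ctt_copair2 : forall (D : ctalg A) (f : cthom B D) (g : cthom C D),
    ctt_copair f g \o ctt_in2 =1 g;
  ctt_uniq : forall (D : ctalg A) (h k : cthom ctt_sort D),
    h \o ctt_in1 =1 k \o ctt_in1 -> h \o ctt_in2 =1 k \o ctt_in2 -> h =1 k
}.

Arguments ctt_in1 {A B C} _.
Arguments ctt_in2 {A B C} _.
Arguments ctt_copair {A B C} _ {D} _ _.

(* Commutative and cocommutative; [hopf_ten2] is B (x) B and [hopf_ten3] is
   (B (x) B) (x) B. *)
Record hopf (A : comPzRingType) := Hopf {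
  hopf_sort :> ctalg A;
  hopf_ten2 : cttensor hopf_sort hopf_sort;
  hopf_ten3 : cttensor hopf_ten2 hopf_sort;
  hopf_psi : cthom hopf_sort hopf_ten2;
  hopf_counit : cthom hopf_sort (ct_disc A);
  hopf_antipode : cthom hopf_sort hopf_sort;
  (* (psi (x) 1) psi = (1 (x) psi) psi *)
  hopf_coassoc :
    let in12 := ctt_in1 hopf_ten3 in
    let in3 := ctt_in2 hopf_ten3 in
    let in1 := cth_comp in12 (ctt_in1 hopf_ten2) in
    let in2 := cth_comp in12 (ctt_in2 hopf_ten2) in
    let in23 := ctt_copair hopf_ten2 in2 in3 in
    ctt_copair hopf_ten2 (cth_comp in12 hopf_psi) in3 \o hopf_psi
      =1 ctt_copair hopf_ten2 in1 (cth_comp in23 hopf_psi) \o hopf_psi;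
  hopf_counitl :
    ctt_copair hopf_ten2 (cth_comp (ct_eta hopf_sort) hopf_counit)
      (cth_id hopf_sort) \o hopf_psi =1 id;
  hopf_cocomm :
    ctt_copair hopf_ten2 (ctt_in2 hopf_ten2) (ctt_in1 hopf_ten2) \o hopf_psi
      =1 hopf_psi;
  hopf_antipodel :
    ctt_copair hopf_ten2 hopf_antipode (cth_id hopf_sort) \o hopf_psi
      =1 ct_eta hopf_sort \o hopf_counit
}.

Arguments hopf_ten2 {A} _.
Arguments hopf_psi {A} _.
Arguments hopf_counit {A} _.

(* The character group (Z/2)^* is [bool], with the product [addb]; [false] is
   the trivial character and [true] is alpha.  The Hopf algebra dual to
   A[(Z/2)^*] is the algebra of functions on (Z/2)^*, with
   psi(f)(c, d) = f(c d) and counit f |-> f(1); a homomorphism theta into it is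
   given by its components. *)
Definition hopf_hom_dual (A : comPzRingType) (B : hopf A)
    (theta : bool -> cthom B (ct_disc A)) : Prop :=
  theta false =1 hopf_counit B /\
  forall c d, ctt_copair (hopf_ten2 B) (theta c) (theta d) \o hopf_psi B
                =1 theta (c (+) d).

(* The translate of x by the character c: psi followed by 1 (x) theta_c. *)
Definition translate (A : comPzRingType) (B : hopf A)
    (theta : bool -> cthom B (ct_disc A)) (c : bool) (x : B) : B :=
  ctt_copair (hopf_ten2 B) (cth_id B) (cth_comp (ct_eta B) (theta c))
    (hopf_psi B x).

(* The topology of B is the z-adic one. *)
Definition principal_topology (A : comPzRingType) (B : ctalg A) (z : B) :=
  (forall I, ct_nbhs B I -> exists n, forall b, I (z ^+ n * b)) /\
  (forall n, exists2 I, ct_nbhs B I & forall b, I b -> exists b', b = z ^+ n * b').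

Record efgl (A : comPzRingType) := EFGL {
  efgl_hopf :> hopf A;
  efgl_theta : bool -> cthom efgl_hopf (ct_disc A);
  efgl_x : efgl_hopf;
  efgl_thetaP : hopf_hom_dual efgl_theta;
  efgl_regular : forall b, efgl_x * b = 0 -> b = 0;
  efgl_kernel : forall b, efgl_theta false b = 0 <-> exists b', b = efgl_x * b';
  efgl_topology :
    principal_topology (efgl_x * translate efgl_theta true efgl_x)
}.

Section EFGLTheory.
Variables (A : comPzRingType) (E : efgl A).

Let x : E := efgl_x E.
Let EE := hopf_ten2 E.
Let x1 : EE := ctt_in1 EE x.
Let x2 : EE := ctt_in2 EE x.

Definition efgl_psi_x : EE := hopf_psi E x.

Definition euler_class : A := efgl_theta E true x.

Definition efgl_multiplicative : Prop :=
  exists v : A, efgl_psi_x = x1 + x2 + ct_unit EE v * (x1 * x2).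

(* F is the underlying formal group law: after completion at (x), which turns
   B into A[[x]], psi(x) becomes F(x (x) 1, 1 (x) x). *)
Definition efgl_underlying (F : ser2 A) : Prop :=
  forall n, exists r1 r2 : EE,
    efgl_psi_x = \sum_(i < n) \sum_(j < n) ct_unit EE (F i j) * (x1 ^+ i * x2 ^+ j)
                 + x1 ^+ n * r1 + x2 ^+ n * r2.

(* psi(x) = \sum_i x^i (x) f i, x-adically in the first factor. *)
Definition efgl_expansion (f : nat -> E) : Prop :=
  forall n, exists r : EE,
    efgl_psi_x = \sum_(i < n) x1 ^+ i * ctt_in2 EE (f i) + x1 ^+ n * r.

(* The n-th remainder g_n in the x-adic expansion
   g = a_0 + a_1 x + ... + a_(n-1) x^(n-1) + g_n x^n  with coefficients in A. *)
Definition efgl_rem (n : nat) (g : E) : E :=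
  iter n (fun h => xget 0 [set k | h = ct_unit E (efgl_theta E false h) + x * k]) g.

(* The pull-back of x along the squaring map of the group. *)
Definition efgl_two_x : E :=
  ctt_copair EE (cth_id E) (cth_id E) efgl_psi_x.

End EFGLTheory.

(* The correspondence between homomorphisms MU^{Z/2}_* -> A and equivariant
   formal group laws over A.  The a_{ij} are the coefficients of the underlying
   formal group law, u is the Euler class, b_{ij} is the value at alpha of the
   j-th remainder of f_i, where psi(x) = \sum_i x^i (x) f_i, and q_j is that of
   the j-th remainder of [2]x.  An element g with the expansion
   g = a_0 + a_1 x + ... satisfies
   theta_alpha(g_j) = a_j + u theta_alpha(g_{j+1}), which gives the relations
   b_{ij} = a_{ij} + u b_{i,j+1} and q_j = c_j + u q_{j+1}; and
   q_0 = theta_alpha([2]x) = theta_{alpha^2}(x) = 0.  The b_{i0} are the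
   coefficients of x_alpha = \sum_i b_{i0} x^i, where b_{00} = u. *)
Definition efgl_classified (A : comPzRingType) (phi : {rmorphism MUZ2 -> A})
    (E : efgl A) : Prop :=
  [/\ efgl_underlying E (fun i j => phi (MUZ2_a i j)),
      phi MUZ2_u = euler_class E,
      exists2 f : nat -> E, efgl_expansion f &
        forall i j, (1 <= i)%N ->
          phi (MUZ2_b i j) = efgl_theta E true (efgl_rem j (f i)) &
      forall j, phi (MUZ2_q j) = efgl_theta E true (efgl_rem j (efgl_two_x E))].

Notation Zuw := {poly {poly int}}.

Definition Zuw_u : Zuw := 'X%:P.
Definition Zuw_w : Zuw := 'X.

Definition exA := ringquot
  [set Zuw_u * (Zuw_u + 2%:R) * (1 - Zuw_u * Zuw_w) : Zuw].

HB.instance Definition _ := GRing.ComPzRing.on exA.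

Definition exA_u : exA := ringquot_pi _ Zuw_u.
Definition exA_w : exA := ringquot_pi _ Zuw_w.

Definition ex_hom (phi : {rmorphism MUZ2 -> exA}) : Prop :=
  [/\ phi MUZ2_u = exA_u,
      (phi (MUZ2_a 1 1) = 1 /\
       forall i j, (1 < i)%N || (1 < j)%N -> phi (MUZ2_a i j) = 0),
      phi (MUZ2_b 1 1) = 1,
      (forall i j, (1 <= i)%N -> (1 < i)%N || (1 < j)%N ->
         phi (MUZ2_b i j) = 0) &
      forall k, (3 <= k)%N ->
        phi (MUZ2_q k) = - exA_u * (exA_u + 2%:R) * exA_w ^+ k].

(* Main.v *)
(** Put j = u (u + 2).  Over A / j the required group is the multiplicative one, with
    x_alpha = u + (1 + u) x; over A / (1 - u w), where u is invertible, it is Z/2 x Gm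
    with coordinate x = (y, u + (1 + u) y) on A[[y]] x A[[y]].  The two agree where they
    meet, and glue to B = A[[t]] + A[[t]] x with x^2 = (u + j w y) x + t, where y is the
    small solution of y = - w (t + (1 + u) y^2).  Since j u w = j, all relations that
    carry a factor j may be checked as if w = 1/u.  With q = w (x - y) the element
    g = 1 + x - j w q is group-like, and
      psi(x) = x_1 + x_2 + x_1 x_2 - j q_1 q_2.
    The algebra C[[t]] + C[[t]] x over a complete algebra C is the coproduct of C and B:
    its homomorphisms are homomorphisms from C together with a triple (g, y, q), where y
    and q matter only after multiplication by j.  Such triples form a group, and the Hopf
    algebra axioms become polynomial identities.  From [2]x = 2 x + x^2 - j q^2 and the
    x-divisibility of j q one reads off q_k = - j w^k for k >= 3; for a multiplicative
    law q_3 = 0, while j w^3 <> 0 in A, as the point u = w = 1 shows. *)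

Require Import Defs.
From HB Require Import structures.
From mathcomp Require Import all_boot all_order all_algebra.
From mathcomp Require Import finmap.
From mathcomp Require Import all_classical topology.
From mathcomp Require Import ring fraction.

Set Implicit Arguments.
Unset Strict Implicit.
Unset Printing Implicit Defensive.

Import GRing.Theory.
Local Open Scope classical_set_scope.
Local Open Scope ring_scope.

(** * Formal power series *)

(** Since alpha^2 = 1, a multiplicative law with v = 1 gives u^2 + 2 u = 0, that is j = 0; the
    example therefore has to use the locus where j does not vanish. There u has an inverse, the
    completion at (x x_alpha) splits into one factor for each character, and the coordinate on the
    factor of alpha may be chosen separately. The choice u + (1 + u) y becomes the multiplicative
    translate u + (1 + u) x when j = 0, which is what allows the two models to be glued. Completion
    at (x) keeps only the trivial factor, where x = y is the usual coordinate of Gm, so the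
    underlying law does not notice the change. Tensor products are known only through their
    universal property. The algebra is therefore built over an arbitrary complete C and not just
    over A: the double and triple tensor products are then the same construction iterated. *)

Definition fps (R : comPzRingType) := nat -> R.

HB.instance Definition _ R := gen_eqMixin (fps R).
HB.instance Definition _ R := gen_choiceMixin (fps R).

Section FormalPowerSeries.
Variable R : comPzRingType.
Implicit Types a b c : fps R.

Let addA : associative (fun a b : fps R => (fun n => a n + b n) : fps R).
Proof. by move=> a b c; apply/funext => n; rewrite addrA. Qed.
Let addC : commutative (fun a b : fps R => (fun n => a n + b n) : fps R).
Proof. by move=> a b; apply/funext => n; rewrite addrC. Qed.
Let add0 : left_id ((fun=> 0) : fps R) (fun a b => (fun n => a n + b n) : fps R).
Proof. by move=> a; apply/funext => n; rewrite add0r. Qed.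
Let addN : left_inverse ((fun=> 0) : fps R) (fun a => (fun n => - a n) : fps R)
  (fun a b => (fun n => a n + b n) : fps R).
Proof. by move=> a; apply/funext => n; rewrite addNr. Qed.

HB.instance Definition _ := GRing.isZmodule.Build (fps R) addA addC add0 addN.

Definition fps_shift a : fps R := fun n => a n.+1.
Definition fpsC (r : R) : fps R := fun n => if n is 0 then r else 0.
Definition fpsX : fps R := fun n => (n == 1)%:R.

(* (a_0 + X a') b = a_0 b + X (a' b) *)
Fixpoint fps_mul_rec (n : nat) a b : R :=
  a 0%N * b n + (if n is m.+1 then fps_mul_rec m (fps_shift a) b else 0).
Definition fps_mul a b : fps R := fun n => fps_mul_rec n a b.

Lemma fps_addE a b n : (a + b) n = a n + b n. Proof. by []. Qed.
Lemma fps_oppE a n : (- a) n = - a n. Proof. by []. Qed.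

Let mulS a b n :
  fps_mul a b n.+1 = a 0%N * b n.+1 + fps_mul (fps_shift a) b n.
Proof. by []. Qed.

Let mulD : left_distributive fps_mul +%R.
Proof.
move=> a b c; apply/funext => n; rewrite fps_addE /fps_mul.
elim: n a b => [|n IH] a b /=; first by rewrite !addr0 mulrDl.
have -> : fps_shift (a + b) = fps_shift a + fps_shift b by [].
by rewrite IH fps_addE mulrDl addrACA.
Qed.

Let mulC : commutative fps_mul.
Proof.
have mulr a b n : fps_mul a b n.+1 = a n.+1 * b 0%N + fps_mul a (fps_shift b) n.
  elim: n a => [|n IH] a; first by rewrite /fps_mul /= !addr0 addrC.
  by rewrite mulS IH [in RHS]mulS addrCA.
move=> a b; apply/funext => n.
elim: n a b => [|n IH] a b; first by rewrite /fps_mul /= !addr0 mulrC.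
by rewrite mulr -IH mulrC.
Qed.

Let mulZ r a b : fps_mul (fun n => r * a n) b = (fun n => r * fps_mul a b n).
Proof.
apply/funext => n; elim: n a => [|n IH] a.
  by rewrite /fps_mul /= !addr0 mulrA.
by rewrite !mulS mulrDr mulrA -IH.
Qed.

Let mulA : associative fps_mul.
Proof.
move=> a b c; apply/funext => n; elim: n a => [|n IH] a.
  by rewrite /fps_mul /= !addr0 mulrA.
rewrite [LHS]mulS [RHS]mulS IH.
have -> : fps_shift (fps_mul a b) =
    ((fun k => a 0%N * fps_shift b k) : fps R) + fps_mul (fps_shift a) b.
  exact/funext.
rewrite mulD fps_addE mulZ addrA mulS mulrDr; congr (_ + _ + _).
by rewrite [fps_mul _ _ 0]/= addr0 mulrA.
Qed.

Let mul1 : left_id (fpsC 1) fps_mul.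
Proof.
have mul0 a n : fps_mul 0 a n = 0.
  by elim: n => [|n IH]; rewrite /fps_mul /= mul0r add0r //.
move=> a; apply/funext => -[|n]; rewrite /fps_mul /= mul1r ?addr0 //.
by rewrite [X in _ + X](mul0 a n) addr0.
Qed.

HB.instance Definition _ :=
  GRing.Zmodule_isComPzRing.Build (fps R) mulA mulC mul1 mulD.

Lemma fps_mul0E a b : (a * b) 0%N = a 0%N * b 0%N.
Proof. exact: addr0. Qed.

Lemma fps_mulSE a b n :
  (a * b) n.+1 = a 0%N * b n.+1 + (fps_shift a * b) n.
Proof. by []. Qed.

Lemma fpsC_zmod : zmod_morphism fpsC.
Proof. by move=> r s; apply/funext => -[|n]; rewrite // fps_addE /= subr0. Qed.

Lemma coef_fpsCM r a n : (fpsC r * a) n = r * a n.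
Proof.
case: n => [|n]; first by rewrite fps_mul0E.
rewrite fps_mulSE -[fps_shift _]/(0 : fps R) mul0r; exact: addr0.
Qed.

Lemma fpsC_monoid : monoid_morphism fpsC.
Proof.
by split=> // r s; apply/funext => n; rewrite coef_fpsCM; case: n => //= n; rewrite mulr0.
Qed.

HB.instance Definition _ := GRing.isZmodMorphism.Build R (fps R) fpsC fpsC_zmod.
HB.instance Definition _ := GRing.isMonoidMorphism.Build R (fps R) fpsC fpsC_monoid.

Lemma coef0_fpsXM a : (fpsX * a) 0%N = 0.
Proof. by rewrite fps_mul0E mul0r. Qed.

Lemma coefS_fpsXM a n : (fpsX * a) n.+1 = a n.
Proof.
rewrite fps_mulSE mul0r add0r.
have -> : fps_shift fpsX = 1 by apply/funext => -[].
by rewrite mul1r.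
Qed.

Lemma fps_shiftE a : a = fpsC (a 0%N) + fpsX * fps_shift a.
Proof.
apply/funext => -[|n]; rewrite fps_addE ?coef0_fpsXM ?coefS_fpsXM /=.
  by rewrite addr0.
by rewrite add0r.
Qed.

Lemma fpsX_regular a : fpsX * a = 0 -> a = 0.
Proof. by move=> h; apply/funext => n; rewrite -coefS_fpsXM h. Qed.

Lemma fps_vanishP n a :
  (forall k, (k < n)%N -> a k = 0) <-> exists b, a = fpsX ^+ n * b.
Proof.
split=> [|[b ->] k].
  elim: n a => [|n IH] a an; first by exists a; rewrite mul1r.
  have [k kn|b eb] := IH (fps_shift a); first exact: an.
  by exists b; rewrite [LHS]fps_shiftE an // rmorph0 add0r exprS -mulrA -eb.
elim: n k => [//|n IH] [|k] kn; first by rewrite exprS -mulrA coef0_fpsXM.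
by rewrite exprS -mulrA coefS_fpsXM IH.
Qed.

Lemma fps_inv1X : exists a, a * (1 + fpsX) = 1.
Proof.
exists (fun n => (- 1) ^+ n); rewrite mulrDr mulr1 [_ * fpsX]mulrC.
apply/funext => -[|n]; rewrite fps_addE ?coef0_fpsXM ?coefS_fpsXM ?addr0 //.
by rewrite exprS mulN1r addNr.
Qed.

Lemma fps_mul_vanish m n a b : (forall k, (k < m)%N -> a k = 0) ->
  (forall k, (k < n)%N -> b k = 0) -> forall k, (k < m + n)%N -> (a * b) k = 0.
Proof.
move=> /fps_vanishP[a' ->] /fps_vanishP[b' ->]; apply/fps_vanishP.
by exists (a' * b'); rewrite exprD mulrACA.
Qed.

(* The root with zero constant term of Y = p (X + q Y^2); the (n + 1)-st iterate of
   the contraction Y |-> p (X + q Y^2) is correct up to degree n. *)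
Definition fps_quad (p q : R) : fps R := fun n =>
  iter n.+1 (fun Y : fps R => fpsC p * (fpsX + fpsC q * Y ^+ 2)) 0 n.

Lemma fps_quad0 p q : fps_quad p q 0%N = 0.
Proof.
by rewrite /fps_quad /= coef_fpsCM fps_addE coef_fpsCM expr0n /= !(mulr0, addr0). Qed.

Lemma fps_quadE p q :
  fps_quad p q = fpsC p * (fpsX + fpsC q * fps_quad p q ^+ 2).
Proof.
pose F (Y : fps R) : fps R := fpsC p * (fpsX + fpsC q * Y ^+ 2).
have F0 (Y : fps R) : Y 0%N = 0 -> F Y 0%N = 0.
  by move=> Y0; rewrite /F expr2 coef_fpsCM fps_addE coef_fpsCM fps_mul0E Y0 mulr0 mulr0 addr0 mulr0.
have FF n (Y Z : fps R) : Y 0%N = 0 -> Z 0%N = 0 -> (forall k, (k < n)%N -> Y k = Z k) ->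
    forall k, (k < n.+1)%N -> F Y k = F Z k.
  move=> Y0 Z0 YZ k kn; apply/eqP; rewrite -subr_eq0; apply/eqP.
  rewrite -[LHS]/((F Y - F Z) k).
  (* The factor Y + Z has no constant term, so F raises the order of agreement by one. *)
  have -> : F Y - F Z = fpsC (p * q) * ((Y - Z) * (Y + Z)) by rewrite /F; ring.
  rewrite coef_fpsCM (@fps_mul_vanish n 1) ?mulr0 ?addn1 // => i.
    by move=> /YZ e; rewrite fps_addE fps_oppE e subrr.
  by case: i => // _; rewrite fps_addE Y0 Z0 addr0.
pose G n : fps R := iter n F 0.
have G0 n : G n 0%N = 0 by elim: n => // n IH; apply: F0.
have GS n k : (k < n)%N -> G n k = G n.+1 k.
  elim: n k => // n IH k; exact: (FF n (G n) (G n.+1)).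
have GE n k : (k < n)%N -> G n k = fps_quad p q k.
  elim: n k => // n IH k; rewrite ltnS leq_eqVlt => /orP[/eqP->//|kn].
  by rewrite -GS // IH.
apply/funext => n; rewrite -(GE n.+2 n) //.
apply: (FF n.+1 (G n.+1) (fps_quad p q)) => // [|k kn].
  exact: fps_quad0.
exact: GE.
Qed.

End FormalPowerSeries.

(** * Quadratic extensions of a commutative ring *)

(** The type carries s and t so that a multiplication depending on them can be attached to it; the
    bare product already has the componentwise one. *)
Definition quadext (P : comPzRingType) (s t : P) : Type := (P * P)%type.

Section QuadraticExtension.
Variables (P : comPzRingType) (s t : P).

HB.instance Definition _ := GRing.Zmodule.copy (quadext s t) (P * P)%type.

Let one : quadext s t := (1, 0).
(* x^2 = s x + t, with (a, b) standing for a + b x *)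
Let mul (p q : quadext s t) : quadext s t :=
  (p.1 * q.1 + t * (p.2 * q.2), p.1 * q.2 + p.2 * q.1 + s * (p.2 * q.2)).

Let mulA : associative mul.
Proof. by move=> [a b] [c d] [e f]; congr (_, _); rewrite /=; ring. Qed.
Let mulC : commutative mul.
Proof. by move=> [a b] [c d]; congr (_, _); rewrite /=; ring. Qed.
Let mul1 : left_id one mul.
Proof. by move=> [a b]; congr (_, _); rewrite /=; ring. Qed.
Let mulD : left_distributive mul +%R.
Proof. by move=> [a b] [c d] [e f]; congr (_, _); rewrite /=; ring. Qed.

HB.instance Definition _ :=
  GRing.Zmodule_isComPzRing.Build (quadext s t) mulA mulC mul1 mulD.

Definition quadextC (a : P) : quadext s t := (a, 0).
Definition quadextX : quadext s t := (0, 1).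

Lemma quadext_mulE (p q : quadext s t) : p * q =
  (p.1 * q.1 + t * (p.2 * q.2), p.1 * q.2 + p.2 * q.1 + s * (p.2 * q.2)).
Proof. by []. Qed.

Let C_zmod : zmod_morphism quadextC.
Proof. by move=> a b; congr (_, _); rewrite /= subrr. Qed.
Let C_monoid : monoid_morphism quadextC.
Proof. by split=> // a b; rewrite quadext_mulE; congr (_, _); rewrite /=; ring. Qed.

HB.instance Definition _ :=
  GRing.isZmodMorphism.Build P (quadext s t) quadextC C_zmod.
HB.instance Definition _ :=
  GRing.isMonoidMorphism.Build P (quadext s t) quadextC C_monoid.

Lemma quadextX2 : quadextX ^+ 2 = quadextC s * quadextX + quadextC t.
Proof. by rewrite expr2 !quadext_mulE; congr (_, _); rewrite /=; ring. Qed.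

Section Hom.
Variables (R : comPzRingType) (f : {rmorphism P -> R}) (x : R).
Hypothesis x2 : x ^+ 2 = f s * x + f t.

(** The relation is an argument so that the term itself determines the morphism instances declared
    below. *)
Definition quadext_hom of x ^+ 2 = f s * x + f t :=
  fun p : quadext s t => f p.1 + f p.2 * x.

Let hom_zmod : zmod_morphism (quadext_hom x2).
Proof. by move=> p q; rewrite /quadext_hom !rmorphB /=; ring. Qed.
Let hom_monoid : monoid_morphism (quadext_hom x2).
Proof.
split=> [|p q]; rewrite /quadext_hom ?rmorph1 ?rmorph0 /= ?mul0r ?addr0 //.
rewrite !(rmorphD, rmorphM) /= -!/(f _).
have -> : f t = x ^+ 2 - f s * x by rewrite x2; ring.
ring.
Qed.

HB.instance Definition _ :=
  GRing.isZmodMorphism.Build (quadext s t) R (quadext_hom x2) hom_zmod.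
HB.instance Definition _ :=
  GRing.isMonoidMorphism.Build (quadext s t) R (quadext_hom x2) hom_monoid.
End Hom.
End QuadraticExtension.

(** * Linear topologies and evaluation of power series *)

Section Ideals.
Variables (R : comPzRingType) (I : set R).
Hypothesis II : is_ideal I.

Lemma ideal0 : I 0. Proof. by have [] := II. Qed.
Lemma idealD x y : I x -> I y -> I (x + y). Proof. by have [_ + _] := II; apply. Qed.
Lemma idealM a x : I x -> I (a * x). Proof. by have [_ _] := II; apply. Qed.
Lemma idealMr a x : I x -> I (x * a). Proof. by rewrite mulrC; apply: idealM. Qed.
Lemma idealN x : I x -> I (- x). Proof. by rewrite -mulN1r; apply: idealM. Qed.
Lemma idealB x y : I x -> I y -> I (x - y).
Proof. by move=> Ix Iy; apply: idealD => //; apply: idealN. Qed.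
Lemma idealBC x y : I (x - y) -> I (y - x).
Proof. by move=> /idealN; rewrite opprB. Qed.
Lemma ideal_trans y x z : I (x - y) -> I (y - z) -> I (x - z).
Proof. by move=> h /(idealD h); rewrite addrA subrK. Qed.
Lemma idealX n x k : I (x ^+ n) -> (n <= k)%N -> I (x ^+ k).
Proof. by move=> Ix /subnK<-; rewrite exprD; apply: idealM. Qed.

Lemma ideal_fps_mul n (a b : fps R) : (forall k, (k < n)%N -> I (b k)) ->
  forall k, (k < n)%N -> I ((a * b) k).
Proof.
move=> Ib k; elim: k a => [|k IH] a kn.
  by rewrite fps_mul0E; apply/idealM/Ib.
rewrite fps_mulSE; apply: idealD; first exact/idealM/Ib.
exact/IH/ltnW.
Qed.
End Ideals.

Section TopologicallyNilpotent.
Variables (A : comPzRingType) (D : ctalg A).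
Implicit Types a b c d : D.

Lemma ct_nbhs0 J : ct_nbhs D J -> J 0.
Proof. by move=> DJ; have [] := ct_ideal DJ. Qed.

(** Both a and b are limits of the constant family b, and limits are unique by [ct_complete]. *)
Lemma ct_separated a b : (forall J, ct_nbhs D J -> J (a - b)) -> a = b.
Proof.
move=> Jab; have [|l [_ lu]] := @ct_complete _ D (fun=> b).
  by move=> I J _ DJ _; rewrite subrr; apply: ct_nbhs0.
by rewrite -(lu _ Jab) (lu b) // => J DJ; rewrite subrr; apply: ct_nbhs0.
Qed.

(** These are the elements at which every power series can be evaluated: as J is an ideal, one power
    in J puts all later terms in J. *)
Definition topnil c := forall J, ct_nbhs D J -> exists n, J (c ^+ n).

Lemma topnil0 : topnil 0.
Proof. by move=> J DJ; exists 1; rewrite expr1; apply: ct_nbhs0. Qed.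

Lemma topnilM a c : topnil c -> topnil (a * c).
Proof.
move=> nc J DJ; have [n Jn] := nc J DJ; exists n.
by rewrite exprMn; apply: idealM => //; apply: ct_ideal.
Qed.

Lemma topnilD c d : topnil c -> topnil d -> topnil (c + d).
Proof.
move=> nc nd J DJ; have [n Jn] := nc J DJ; have [m Jm] := nd J DJ.
have IJ := ct_ideal DJ; exists (n + m)%N; rewrite exprDn_comm; last exact: mulrC.
apply: (big_ind J); [exact: ideal0|exact: idealD|move=> i _].
rewrite -mulr_natl; apply: idealM => //.
have [le|lt] := leqP m i; first by apply: idealM => //; apply: idealX Jm le.
apply: idealMr => //; apply: (idealX IJ Jn).
by rewrite -addnBA ?leq_addr // ltnW.
Qed.

Lemma topnil_sqrt c : topnil (c ^+ 2) -> topnil c.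
Proof.
by move=> nc J DJ; have [n] := nc J DJ; rewrite -exprM; exists (2 * n)%N.
Qed.

Lemma topnilB c d : topnil c -> topnil d -> topnil (c - d).
Proof. by move=> nc nd; apply: topnilD => //; rewrite -mulN1r; apply: topnilM. Qed.

End TopologicallyNilpotent.

Lemma topnil_hom (A : comPzRingType) (D E : ctalg A) (f : cthom D E) c :
  topnil c -> topnil (f c).
Proof.
move=> nc J EJ; have [I DI IJ] := cth_continuous f EJ.
by have [n In] := nc I DI; exists n; rewrite -rmorphXn; apply: IJ.
Qed.

Section Evaluation.
Variables (A R : comPzRingType) (D : ctalg A) (f : {rmorphism R -> D}) (c : D).
Implicit Types a b : fps R.

Definition fps_psum n a : D := \sum_(k < n) f (a k) * c ^+ k.

Lemma fps_psumB n m a J : is_ideal J -> J (c ^+ n) -> (n <= m)%N ->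
  J (fps_psum m a - fps_psum n a).
Proof.
move=> IJ Jc nm; rewrite /fps_psum -!(big_mkord xpredT (fun k => f (a k) * c ^+ k)).
rewrite (big_cat_nat _ (n := n)) //= addrAC subrr add0r big_nat_cond.
apply: (big_ind J); [exact: ideal0|exact: idealD|move=> i /andP[/andP[ni _] _]].
by apply: idealM => //; apply: idealX ni.
Qed.

Hypothesis nc : topnil c.

Lemma fps_eval_ex a : exists l : D, forall J n, ct_nbhs D J -> J (c ^+ n) ->
  J (l - fps_psum n a).
Proof.
(* [N J] is a truncation order that is good enough for J; for sets that are not neighbourhoods its
   value is arbitrary. *)
have /choice[N NP] : forall J : set D, exists n, ct_nbhs D J -> J (c ^+ n).
  move=> J; have [/nc[n Jn]|] := pselect (ct_nbhs D J); first by exists n.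
  by exists 0%N.
(* Partial sums cut at any two good orders agree modulo J, so the family is compatible and its limit
   does not depend on N. *)
have NJ I J n m : ct_nbhs D J -> I `<=` J -> I (c ^+ m) -> J (c ^+ n) ->
    J (fps_psum m a - fps_psum n a).
  move=> DJ IJ Im Jn; have JI := ct_ideal DJ.
  have [le|/ltnW le] := leqP n m; first exact: fps_psumB.
  by apply: idealBC => //; apply: fps_psumB => //; apply: IJ.
have [|l [ls _]] := @ct_complete _ D (fun J => fps_psum (N J) a).
  by move=> I J DI DJ IJ; apply: NJ IJ _ _ => //; apply: NP.
exists l => J n DJ Jn; apply: ideal_trans (ls J DJ) _; first exact: ct_ideal.
by apply: (NJ J) => //; apply: NP.
Qed.

Definition fps_eval := fun a => projT1 (cid (fps_eval_ex a)).

Local Notation ev := fps_eval.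

Lemma fps_evalP a J n : ct_nbhs D J -> J (c ^+ n) -> J (ev a - fps_psum n a).
Proof. exact: (projT2 (cid (fps_eval_ex a))). Qed.

Lemma fps_eval_eq l a : (forall J, ct_nbhs D J ->
  exists n, J (c ^+ n) /\ J (l - fps_psum n a)) -> ev a = l.
Proof.
move=> h; apply: ct_separated => J DJ; have [n [Jn Jl]] := h J DJ.
have JI := ct_ideal DJ.
by apply: (ideal_trans JI (fps_evalP a DJ Jn)); apply: idealBC.
Qed.

Lemma fps_eval_zmod : zmod_morphism ev.
Proof.
move=> a b; apply: fps_eval_eq => J DJ; have [n Jn] := nc DJ.
have JI := ct_ideal DJ; exists n; split=> //.
have -> : fps_psum n (a - b) = fps_psum n a - fps_psum n b.
  by rewrite -sumrB; apply: eq_bigr => k _; rewrite -mulrBl -rmorphB.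
by rewrite opprD addrACA -opprD; apply: idealB => //; apply: fps_evalP.
Qed.

HB.instance Definition _ := GRing.isZmodMorphism.Build (fps R) D ev fps_eval_zmod.

Lemma fps_evalZ r a : ev (fpsC r * a) = f r * ev a.
Proof.
apply: fps_eval_eq => J DJ; have [n Jn] := nc DJ; exists n; split=> //.
have -> : fps_psum n (fpsC r * a) = f r * fps_psum n a.
  by rewrite mulr_sumr; apply: eq_bigr => k _; rewrite coef_fpsCM rmorphM mulrA.
by rewrite -mulrBr; apply: idealM; [exact: ct_ideal|exact: fps_evalP].
Qed.

Lemma fps_evalXM a : ev (fpsX R * a) = c * ev a.
Proof.
apply: fps_eval_eq => J DJ; have [n Jn] := nc DJ; exists n.+1.
have JI := ct_ideal DJ; split; first by rewrite exprS; apply: idealM.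
have -> : fps_psum n.+1 (fpsX R * a) = c * fps_psum n a.
  rewrite /fps_psum big_ord_recl coef0_fpsXM rmorph0 mul0r add0r mulr_sumr.
  by apply: eq_bigr => k _; rewrite coefS_fpsXM exprS mulrCA.
by rewrite -mulrBr; apply: idealM => //; apply: fps_evalP.
Qed.

Lemma fps_eval1 : ev 1 = 1.
Proof.
apply: fps_eval_eq => J DJ; have [n Jn] := nc DJ; exists n.+1.
have JI := ct_ideal DJ; split; first by rewrite exprS; apply: idealM.
rewrite /fps_psum big_ord_recl big1 => [|k _]; last by rewrite rmorph0 mul0r.
by rewrite rmorph1 mul1r addr0 subrr; apply: ideal0.
Qed.

Lemma fps_evalC r : ev (fpsC r) = f r.
Proof. by rewrite -[fpsC r]mulr1 fps_evalZ fps_eval1 mulr1. Qed.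

Lemma fps_evalE a : ev a = f (a 0%N) + c * ev (fps_shift a).
Proof. by rewrite {1}[a]fps_shiftE raddfD /= fps_evalXM fps_evalC. Qed.

Lemma fps_eval_monoid : monoid_morphism ev.
Proof.
split=> [|a b]; first exact: fps_eval1.
(* Splitting off the constant term of a shows that the defect of
   multiplicativity is divisible by every power of c. *)
have key n : exists d, ev (a * b) - ev a * ev b = c ^+ n * d.
  elim: n a => [|n IH] a; first by exists (ev (a * b) - ev a * ev b); rewrite mul1r.
  have [d ed] := IH (fps_shift a); exists d.
  rewrite exprS -mulrA -ed mulrBr [ev a]fps_evalE {1}[a]fps_shiftE mulrDl raddfD /=.
  by rewrite -mulrA fps_evalZ fps_evalXM; ring.
apply: ct_separated => J DJ; have [n Jn] := nc DJ; have [d ->] := key n.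
by apply: idealMr => //; apply: ct_ideal.
Qed.

HB.instance Definition _ := GRing.isMonoidMorphism.Build (fps R) D ev fps_eval_monoid.

Lemma fps_evalX : ev (fpsX R) = c.
Proof. by rewrite -[fpsX R]mulr1 fps_evalXM fps_eval1 mulr1. Qed.

End Evaluation.

(** The geometric series can be evaluated at -c. *)
Lemma topnil_inv (A : comPzRingType) (D : ctalg A) (c : D) : topnil c ->
  exists d, d * (1 + c) = 1.
Proof.
move=> nc; have [a a1] := fps_inv1X A.
pose e : {rmorphism fps A -> D} := fps_eval (ct_unit D) nc.
exists (e a); rewrite -(fps_evalX (ct_unit D) nc) -[fps_eval _ _ _]/(e (fpsX A)).
by rewrite -(rmorph1 e) -rmorphD -rmorphM a1.
Qed.

(** * The group law on points *)

(* As j u w = j, the relations multiplied by j may be computed as if w = 1/u; there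
   the group is Z/2 x Gm and g = (1 + y, -1 - y), q = (0, 1 + y) on its two components. *)
Section PointAlgebra.
Variables (R : comPzRingType) (u w j : R).
Hypotheses (u2 : u ^+ 2 = j - 2%:R * u) (juw : j * u * w = j).

(** The value of g at alpha: it is 1 + u where j = 0, and -1 where w = 1/u. *)
Definition alpha_g : R := 1 + u - j * w.
Local Notation h := alpha_g.

(** If 1 + y is a unit, the relations say that, up to the annihilator of j, q = (1 + y) e and g = (1
    + y)(1 - 2 e) with e idempotent, the indicator of the component of alpha. *)
Definition is_point (g y q : R) :=
  j * q ^+ 2 = j * ((1 + y) * q) /\ j * g = j * (1 + y - 2%:R * q).
Definition point_x (g q : R) := g - 1 + j * w * q.
(** Where w = 1/u, s is the sum of the two components y and u + (1 + u) y of x, and -t below is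
    their product. *)
Definition point_s (y : R) := u + j * w * y.
Definition point_t (g y q : R) := point_x g q * (point_x g q - point_s y).

Lemma jjw : j * j * w = j * u + 2%:R * j.
Proof.
have jj : j = u ^+ 2 + 2%:R * u by rewrite u2; ring.
by rewrite {2}jj -{2 3}juw; ring.
Qed.

Lemma j_alpha : j * h = - j.
Proof. rewrite /h; ring: jjw. Qed.

Lemma alpha_sqr : h ^+ 2 = 1.
Proof.
rewrite /h; transitivity (1 + 2%:R * u + u ^+ 2 - 2%:R * (j * w) - 2%:R * (j * u * w)
  + (j * j * w) * w); first by ring.
rewrite jjw juw u2; ring: juw.
Qed.

(** Modulo y this identifies t with (g - 1)(g - h), so topological nilpotence passes from either one
    to the other. *)
Lemma point_tE g y q : is_point g y q ->
  point_t g y q = (g - 1) * (g - h) - j * w * y * (1 + y).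
Proof.
move=> [q2 jg]; rewrite /point_t /point_x /point_s /h.
ring: jjw juw jg q2.
Qed.

(** Up to the annihilator of j, t = - y (u + (1 + u) y); multiplication by w isolates the linear
    term, because j u w = j. *)
Lemma point_quad g y q : is_point g y q ->
  j * y = j * (- w * (point_t g y q + (1 + u) * y ^+ 2)).
Proof.
move=> pt; rewrite point_tE // /h; case: pt => q2 jg.
ring: jjw juw jg q2.
Qed.

Lemma is_point_univ x y t :
  x ^+ 2 = (u + j * w * y) * x + t -> y = - w * (t + (1 + u) * y ^+ 2) ->
  is_point (1 + x - j * w * (w * (x - y))) y (w * (x - y)).
Proof.
move=> x2 yE.
(* The equation for y, multiplied by j u and solved for j t. *)
have jt : j * t = - j * (u * y + (1 + u) * y ^+ 2).
  transitivity (- (j * u * (- w * (t + (1 + u) * y ^+ 2)) + j * (1 + u) * y ^+ 2)).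
    ring: juw.
  by rewrite -yE; ring.
have {}x2 : j * x ^+ 2 = j * u * x + (j * u + 2%:R * j) * y * x + j * t.
  by rewrite x2 -jjw; ring.
split; last ring: jjw juw.
transitivity (w ^+ 2 * (j * x ^+ 2 - 2%:R * j * x * y + j * y ^+ 2)); first by ring.
by rewrite x2 jt; ring: juw.
Qed.

(** On the support of q, x equals u + (1 + u) y = u (1 + w (1 + u) y). Hence k is its inverse there,
    and j q can be divided by x any number of times. *)
Lemma point_q_div g y q k n : is_point g y q -> k * (1 + w * (1 + u) * y) = w ->
  j * q = point_x g q ^+ n * (j * k ^+ n * q).
Proof.
move=> [q2 jg] kE; set x := point_x g q.
(* On both components x = y + u q. *)
have jx : j * x = j * (y + u * q).
  transitivity (j * g - j + j * j * w * q); first by rewrite /x /point_x; ring.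
  by rewrite jg jjw; ring.
have step : j * q = x * (j * k * q).
  transitivity (j * u * (k * (1 + w * (1 + u) * y)) * q); first by rewrite kE; ring: juw.
  transitivity (k * ((j * (y + u * q)) * q)); last by rewrite -jx; ring.
  transitivity (k * (j * y * q + u * (j * q ^+ 2))); last by ring.
  by rewrite q2; ring: juw.
elim: n => [|n IH]; first by rewrite !expr0 mul1r mulr1.
transitivity (x ^+ n * k ^+ n * (j * q)); first by rewrite {1}IH; ring.
by rewrite step !exprS; ring.
Qed.

Lemma div_step x k q n : j * q = x * (j * k * q) ->
  j * k ^+ n * q ^+ 2 = x * (j * k ^+ n.+1 * q ^+ 2).
Proof.
move=> h; transitivity (k ^+ n * q * (j * q)); first by ring.
by rewrite {1}h [k ^+ n.+1]exprS; ring.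
Qed.

Lemma is_point_1 : is_point 1 0 0. Proof. by split; ring. Qed.

Lemma is_point_alpha : is_point h 0 1.
Proof. by split; rewrite ?j_alpha; ring. Qed.

(** The units 1 + y are multiplied, and with q = (1 + y) e the idempotents combine to e (1 - e') +
    (1 - e) e', the addition of Z/2. *)
Definition point_mul_y (y y' : R) := y + y' + y * y'.
Definition point_mul_q (y q y' q' : R) := q * (1 + y' - q') + (1 + y - q) * q'.

Lemma is_point_mul g y q g' y' q' : is_point g y q -> is_point g' y' q' ->
  is_point (g * g') (point_mul_y y y') (point_mul_q y q y' q').
Proof.
move=> [q2 jg] [q2' jg']; rewrite /is_point /point_mul_y /point_mul_q; split.
  ring: q2' q2.
rewrite mulrA jg; transitivity ((1 + y - 2%:R * q) * (j * g')); first by ring.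
by rewrite jg'; ring.
Qed.

(** Inversion keeps the idempotent e and inverts 1 + y, so q = (1 + y) e is multiplied by
    [yi ^+ 2]. *)
Lemma is_point_inv g y q gi yi : gi * g = 1 -> yi * (1 + y) = 1 ->
  is_point g y q -> is_point gi (yi - 1) (q * yi ^+ 2).
Proof.
move=> ggi yyi [q2 jg]; split.
  transitivity (yi ^+ 4 * (j * q ^+ 2)); first by ring.
  transitivity (yi ^+ 3 * (yi * (1 + y)) * (j * q)); first by rewrite q2; ring.
  rewrite yyi; ring.
(* This is (1 - 2 e)^2 = 1. *)
have L2 : j * (1 + y - 2%:R * q) * (1 + y - 2%:R * q) = j * (1 + y) ^+ 2.
  ring: q2.
transitivity (j * gi * (yi * (1 + y)) ^+ 2); first by rewrite yyi; ring.
transitivity (gi * yi ^+ 2 * (j * (1 + y) ^+ 2)); first by ring.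
rewrite -L2 -jg.
transitivity (gi * g * yi ^+ 2 * (j * (1 + y - 2%:R * q))); first by ring.
rewrite ggi; transitivity (j * (yi * (yi * (1 + y)) - 2%:R * q * yi ^+ 2)).
  by ring.
rewrite yyi; ring.
Qed.

(** Where w = 1/u, 1 + x is 1 + y on the trivial component and (1 + u)(1 + y) on that of alpha. It
    is multiplicative unless both factors lie over alpha, where (1 + u)^2 = 1 + j has to be
    corrected to 1. *)
Lemma point_x_mul g y q g' y' q' : is_point g y q -> is_point g' y' q' ->
  point_x (g * g') (point_mul_q y q y' q') =
  point_x g q + point_x g' q' + point_x g q * point_x g' q' - j * (q * q').
Proof.
move=> [q2 jg] [q2' jg']; rewrite /point_x /point_mul_q.
ring: jjw juw jg jg' q2 q2'.
Qed.

(** Where w = 1/u, translation by alpha exchanges the two components of x, whose sum is s, and h =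
    -1. Where j = 0, the right-hand side is u + (1 + u) x. *)
Lemma point_x_mul_alpha g y q :
  point_x (g * h) (point_mul_q y q 0 1) = h * (point_x g q - point_s y).
Proof.
rewrite /point_x /point_s /point_mul_q.
have uE : u = h - 1 + j * w by rewrite /h; ring.
rewrite {1}uE; transitivity (h * g - h ^+ 2 + (j * h) * w * (q - 1 - y)); last by ring.
by rewrite alpha_sqr j_alpha; ring.
Qed.

(* In the quotient by (g - 1)(g - h) and (g' - 1)(g' - h), the element
   (g g' - 1)(g g' - h) is (1 + h)(g - 1)(g' - 1), whose square vanishes. *)
Lemma point_mul_sqr g g' : exists a b,
  ((g * g' - 1) * (g * g' - h)) ^+ 2 =
    a * ((g - 1) * (g - h)) + b * ((g' - 1) * (g' - h)).
Proof.
have h2 := alpha_sqr.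
pose m := (g - 1) * (g - h); pose m' := (g' - 1) * (g' - h).
pose c := (g * g' - 1) * (g * g' - h); pose d := (1 + h) * (g - 1) * (g' - 1).
have e1 : c = d + g' ^+ 2 * m + ((1 + h) * g - h) * m'.
  rewrite /c /d /m /m'; ring: h2.
have e2 : d ^+ 2 = (1 + h) ^+ 2 * (g' - 1) ^+ 2 * m.
  rewrite /d /m; ring: h2.
exists ((1 + h) ^+ 2 * (g' - 1) ^+ 2 + g' ^+ 2 * (c + d)),
  (((1 + h) * g - h) * (c + d)).
transitivity (d ^+ 2 + (c - d) * (c + d)); first by rewrite -/c; ring.
by rewrite e2 -/m -/m' {1}e1; ring.
Qed.

(** Modulo (g - 1)(g - h), h (1 + h - g) is an inverse of g. This covers points near alpha, where g
    - 1 need not be topologically nilpotent. *)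
Lemma point_unit g : g * (h * (1 + h - g)) = 1 + - h * ((g - 1) * (g - h)).
Proof. ring: alpha_sqr. Qed.

Lemma point_inv_m g gi : gi * g = 1 ->
  (gi - 1) * (gi - h) = gi ^+ 2 * h * ((g - 1) * (g - h)).
Proof.
move=> ggi; have h2 := alpha_sqr.
transitivity ((gi - gi * g) * (gi - h * (gi * g))); first by rewrite ggi mulr1.
ring: h2.
Qed.

End PointAlgebra.

(** * Truncated expansions of the multiplicative law *)

Section MultLaw.
Variables (R S : comPzRingType) (f : {rmorphism R -> S}) (a b : S).

Lemma mult_law_sum n :
  \sum_(i < n.+2) \sum_(k < n.+2) f (mult_law 1 i k) * (a ^+ i * b ^+ k) =
  a + b + a * b.
Proof.
have E2 i k : mult_law (1 : R) i k.+2 = 0 by case: i => [|[]].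
have E i : \sum_(k < n.+2) f (mult_law 1 i k) * (a ^+ i * b ^+ k) =
    f (mult_law 1 i 0) * a ^+ i + f (mult_law 1 i 1) * (a ^+ i * b).
  rewrite 2!big_ord_recl [X in _ + (_ + X)]big1 => [|k _].
    by rewrite mulr1 addr0.
  by rewrite !lift0 E2 rmorph0 mul0r.
rewrite 2!big_ord_recl [X in _ + (_ + X)]big1 => [|k _].
  by rewrite !E /= rmorph0 rmorph1; ring.
by rewrite E !lift0 /= rmorph0 !mul0r addr0.
Qed.

(** From n = 2 on the double sum is the whole law; for n = 0 and n = 1 the missing terms go into the
    remainders. *)
Lemma mult_law_rem n r : exists r1 r2, a + b + a * b - a ^+ n * r =
  \sum_(i < n) \sum_(k < n) f (mult_law 1 i k) * (a ^+ i * b ^+ k)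
  + a ^+ n * r1 + b ^+ n * r2.
Proof.
case: n => [|[|n]].
- by exists (a + b + a * b - r), 0; rewrite big_ord0; ring.
- by exists (1 + b - r), 1; rewrite !big_ord1 rmorph0; ring.
- by exists (- r), 0; rewrite mult_law_sum; ring.
Qed.

(* X + x + X x = x + (1 + x) X *)
Definition mult_coef (x : R) (i : nat) : R :=
  match i with 0 => x | 1 => 1 + x | _ => 0 end.

Lemma mult_coef_rem x n r : exists r', a + f x + a * f x - a ^+ n * r =
  \sum_(i < n) a ^+ i * f (mult_coef x i) + a ^+ n * r'.
Proof.
case: n => [|[|n]].
- by exists (a + f x + a * f x - r); rewrite big_ord0; ring.
- by exists (1 + f x - r); rewrite big_ord1 /=; ring.
- exists (- r); rewrite 2!big_ord_recl big1 => [|i _]; last first.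
    by rewrite !lift0 /= rmorph0 mulr0.
  by rewrite /= rmorphD rmorph1; ring.
Qed.

End MultLaw.

(** * The complete Hopf algebra *)

Section BaseChange.
Variables (A : comPzRingType) (u w j : A).
Hypotheses (u2 : u ^+ 2 = j - 2%:R * u) (juw : j * u * w = j).

Section Points.
Variable D : ctalg A.
Local Notation e := (ct_unit D).
Local Notation h := (alpha_g (e u) (e w) (e j)).

Lemma ct_u2 : e u ^+ 2 = e j - 2%:R * e u.
Proof. by rewrite -rmorphXn u2 rmorphB rmorphM rmorph_nat. Qed.

Lemma ct_juw : e j * e u * e w = e j.
Proof. by rewrite -!rmorphM juw. Qed.

(** A point of the formal neighbourhood of the subgroup generated by alpha: (g - 1)(g - h) is small
    both near 1 and near alpha. Up to [pt_eq], these are the homomorphisms from [bc (ct_disc A)] to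
    D. *)
Record point := Point {
  point_g : D; point_y : D; point_q : D;
  pointP : is_point (e j) point_g point_y point_q;
  point_y_nil : topnil point_y;
  point_g_nil : topnil ((point_g - 1) * (point_g - h))
}.

Definition pt_x (p : point) := point_x (e w) (e j) (point_g p) (point_q p).
Definition pt_s (p : point) := point_s (e u) (e w) (e j) (point_y p).
Definition pt_t (p : point) := pt_x p * (pt_x p - pt_s p).

Lemma pt_t_nil p : topnil (pt_t p).
Proof.
have := point_tE ct_u2 ct_juw (pointP p); rewrite /point_t -/(pt_t p) => ->.
apply: topnilB; first exact: point_g_nil.
by rewrite -mulrA mulrCA mulrC; apply/topnilM/point_y_nil.
Qed.

Program Definition pt_one : point := @Point 1 0 0 _ _ _.
Next Obligation. exact: is_point_1. Qed.
Next Obligation. exact: topnil0. Qed.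
Next Obligation. by rewrite subrr mul0r; apply: topnil0. Qed.

Program Definition pt_alpha : point := @Point h 0 1 _ _ _.
Next Obligation. exact: is_point_alpha ct_u2 ct_juw. Qed.
Next Obligation. exact: topnil0. Qed.
Next Obligation. by rewrite subrr mulr0; apply: topnil0. Qed.

Program Definition pt_mul (p p' : point) : point :=
  @Point (point_g p * point_g p') (point_mul_y (point_y p) (point_y p'))
    (point_mul_q (point_y p) (point_q p) (point_y p') (point_q p')) _ _ _.
Next Obligation. by move=> p p'; apply: is_point_mul; apply: pointP. Qed.
Next Obligation.
move=> p p'; apply: topnilD; last exact/topnilM/point_y_nil.
by apply: topnilD; apply: point_y_nil.
Qed.
Next Obligation.
move=> p p'; apply: topnil_sqrt.
have [a [b ->]] := point_mul_sqr ct_u2 ct_juw (point_g p) (point_g p').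
by apply: topnilD; apply/topnilM/point_g_nil.
Qed.

Lemma pt_g_inv p : exists gi, gi * point_g p = 1.
Proof.
have [d d1] := topnil_inv (topnilM (- h) (@point_g_nil p)).
exists (d * (h * (1 + h - point_g p))).
by rewrite -mulrA [_ * point_g p]mulrC (point_unit ct_u2 ct_juw).
Qed.

Lemma pt_inv_ex p : exists p' : point, exists yi : D,
  [/\ point_g p' * point_g p = 1, yi * (1 + point_y p) = 1,
      point_y p' = yi - 1 & point_q p' = point_q p * yi ^+ 2].
Proof.
have [gi ggi] := pt_g_inv p; have [yi yyi] := topnil_inv (@point_y_nil p).
have P := is_point_inv ggi yyi (pointP p).
have Pn : topnil (yi - 1).
  rewrite -yyi mulrDr mulr1 opprD addrA subrr add0r -mulNr.
  exact/topnilM/point_y_nil.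
have Pg : topnil ((gi - 1) * (gi - h)).
  by rewrite (point_inv_m ct_u2 ct_juw ggi); apply/topnilM/point_g_nil.
by exists (Point P Pn Pg), yi.
Qed.

Lemma pt_mulx p p' : pt_x (pt_mul p p') =
  pt_x p + pt_x p' + pt_x p * pt_x p' - e j * (point_q p * point_q p').
Proof. exact: point_x_mul ct_u2 ct_juw _ _ _ _ _ _ (pointP p) (pointP p'). Qed.

End Points.

Section PointMap.
Variables (D E : ctalg A) (f : cthom D E).

Program Definition pt_map (p : point D) : point E :=
  @Point E (f (point_g p)) (f (point_y p)) (f (point_q p)) _ _ _.
Next Obligation.
move=> p; have [q2 jg] := pointP p; rewrite /is_point -!(cth_unit f).
split.
  by transitivity (f (ct_unit D j * point_q p ^+ 2)); [ring|rewrite q2; ring].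
by transitivity (f (ct_unit D j * point_g p)); [ring|rewrite jg; ring].
Qed.
Next Obligation. by move=> p; apply/topnil_hom/point_y_nil. Qed.
Next Obligation.
move=> p; have := topnil_hom f (@point_g_nil _ p).
by congr topnil; rewrite /alpha_g -!(cth_unit f); ring.
Qed.

Lemma pt_map_x p : f (pt_x p) = pt_x (pt_map p).
Proof. by rewrite /pt_x /point_x -!(cth_unit f) /=; ring. Qed.

Lemma pt_map_s p : f (pt_s p) = pt_s (pt_map p).
Proof. by rewrite /pt_s /point_s -!(cth_unit f) /=; ring. Qed.

Lemma pt_map_t p : f (pt_t p) = pt_t (pt_map p).
Proof. by rewrite /pt_t rmorphM rmorphB pt_map_x pt_map_s. Qed.

End PointMap.

(** * Base change to a complete algebra C *)

Section Algebra.
Variable C : ctalg A.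
Local Notation e := (ct_unit C).

(* bc C = C[[t]] + C[[t]] x, which is the completed tensor product of C with bc A. *)
Definition bc_y : fps C := fps_quad (- e w) (1 + e u).
Definition bc_s : fps C := fpsC (e u) + fpsC (e j * e w) * bc_y.
Definition bc_ring := quadext bc_s (fpsX C).
HB.instance Definition _ := GRing.ComPzRing.on bc_ring.

Definition bc_in1 : {rmorphism C -> bc_ring} :=
  quadextC bc_s (fpsX C) \o @fpsC C.
Definition bc_unit : {rmorphism A -> bc_ring} := bc_in1 \o e.

Definition bc_nbhd (I : set C) (n : nat) : set bc_ring :=
  [set p | forall k, (k < n)%N -> I (p.1 k) /\ I (p.2 k)].
Definition bc_nbhs : set (set bc_ring) :=
  [set K | exists I n, ct_nbhs C I /\ K = bc_nbhd I n].

Lemma bc_ideal K : bc_nbhs K -> is_ideal K.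
Proof.
move=> [I [n [CI ->]]]; have II := ct_ideal CI; split.
- by move=> k _; split; apply: ideal0.
- move=> p q pI qI k kn; have [p1 p2] := pI k kn; have [q1 q2] := qI k kn.
  by split; apply: idealD.
- move=> a p pI.
  have p1 k : (k < n)%N -> I (p.1 k) by move=> /pI[].
  have p2 k : (k < n)%N -> I (p.2 k) by move=> /pI[].
  have m2 := ideal_fps_mul II a.2 p2.
  rewrite quadext_mulE => k kn; split; rewrite /= !fps_addE.
    by apply: idealD => //; apply: (ideal_fps_mul II _ _ kn).
  apply: idealD => //; last exact: (ideal_fps_mul II _ _ kn).
  apply: idealD => //; first exact: (ideal_fps_mul II _ _ kn).
  exact: (ideal_fps_mul II _ _ kn).
Qed.

Lemma bc_nbhs_ex : bc_nbhs !=set0.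
Proof. by have [I CI] := ct_nbhs_ex C; exists (bc_nbhd I 0), I, 0%N. Qed.

Lemma bc_nbhdS I J m n : I `<=` J -> (n <= m)%N -> bc_nbhd I m `<=` bc_nbhd J n.
Proof.
by move=> IJ nm p Ip k kn; have [|h1 h2] := Ip k; [exact: leq_trans nm|split; apply: IJ].
Qed.

Lemma bc_nbhs_dir I J : bc_nbhs I -> bc_nbhs J ->
  exists2 K, bc_nbhs K & K `<=` I `&` J.
Proof.
move=> [I' [m [CI ->]]] [J' [n [CJ ->]]].
have [K CK KIJ] := ct_nbhs_dir CI CJ.
exists (bc_nbhd K (maxn m n)); first by exists K, (maxn m n).
have KI : K `<=` I' by move=> x /KIJ[].
have KJ : K `<=` J' by move=> x /KIJ[].
by move=> p Kp; split; [apply: bc_nbhdS KI _ _ Kp; exact: leq_maxl|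
  apply: bc_nbhdS KJ _ _ Kp; exact: leq_maxr].
Qed.

Lemma bc_complete (s : set bc_ring -> bc_ring) :
  (forall I J, bc_nbhs I -> bc_nbhs J -> I `<=` J -> J (s I - s J)) ->
  exists! l : bc_ring, forall I, bc_nbhs I -> I (l - s I).
Proof.
(* A neighbourhood [bc_nbhd I n] controls the coefficients of t^k only for k < n; the least such n
   serves to define the k-th coefficients of the limit. *)
move=> sP; pose S I k := s (bc_nbhd I k.+1).
have nb I n : ct_nbhs C I -> bc_nbhs (bc_nbhd I n) by move=> CI; exists I, n.
have SP k I J : ct_nbhs C I -> ct_nbhs C J -> I `<=` J ->
    J ((S I k).1 k - (S J k).1 k) /\ J ((S I k).2 k - (S J k).2 k).
  move=> CI CJ IJ.
  by have := sP _ _ (nb I k.+1 CI) (nb J k.+1 CJ) (bc_nbhdS IJ (leqnn _)); apply.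
have /choice[l1 l1P] k : exists l : C, forall I, ct_nbhs C I -> I (l - (S I k).1 k).
  have [|l [lP _]] := @ct_complete _ C (fun I => (S I k).1 k); last by exists l.
  by move=> I J CI CJ IJ; have [] := SP k I J CI CJ IJ.
have /choice[l2 l2P] k : exists l : C, forall I, ct_nbhs C I -> I (l - (S I k).2 k).
  have [|l [lP _]] := @ct_complete _ C (fun I => (S I k).2 k); last by exists l.
  by move=> I J CI CJ IJ; have [] := SP k I J CI CJ IJ.
exists (l1, l2); split=> [K [I [n [CI ->]]] k kn|[m1 m2] mP].
  have II := ct_ideal CI.
  have := sP _ _ (nb I n CI) (nb I k.+1 CI) (bc_nbhdS (fun x => id) kn).
  move=> /(_ k (ltnSn k)) [h1 h2].
  split; [apply: (ideal_trans II (l1P k I CI))|apply: (ideal_trans II (l2P k I CI))];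
    exact: idealBC.
have mk k I : ct_nbhs C I -> I (m1 k - (S I k).1 k) /\ I (m2 k - (S I k).2 k).
  by move=> CI; apply: (mP _ (nb I k.+1 CI) k).
congr (_, _); apply/funext => k; apply: ct_separated => I CI; have II := ct_ideal CI.
  by apply: (ideal_trans II (l1P k I CI)); apply: idealBC => //; case: (mk k I CI).
by apply: (ideal_trans II (l2P k I CI)); apply: idealBC => //; case: (mk k I CI).
Qed.

Definition bc : ctalg A :=
  CTAlg bc_unit bc_ideal bc_nbhs_ex bc_nbhs_dir bc_complete.

Program Definition bc_inl : cthom C bc := @CTHom _ C bc bc_in1 _ _.
Next Obligation. by []. Qed.
Next Obligation.
move=> _ [I [n [CI ->]]]; exists I => // b Ib.
by move=> -[|k] _; split=> //; apply: ct_nbhs0 CI.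
Qed.

End Algebra.

Section UniversalPoint.
Variable C : ctalg A.
Local Notation e := (ct_unit (bc C)).
Local Notation inC := (quadextC (bc_s C) (fpsX C)).

Definition bc_X : bc C := quadextX (bc_s C) (fpsX C).
Definition bc_T : bc C := inC (fpsX C).
Definition bc_Y : bc C := inC (bc_y C).
Definition bc_Q : bc C := e w * (bc_X - bc_Y).

Lemma bc_T_mulX n (p : bc C) : exists a b, bc_T ^+ n * p = (fpsX C ^+ n * a, fpsX C ^+ n * b).
Proof.
exists p.1, p.2; rewrite -[bc_T ^+ n]/(inC (fpsX C) ^+ n) -rmorphXn /=.
by rewrite quadext_mulE; congr (_, _); rewrite /= !mul0r ?mulr0 ?addr0.
Qed.

Lemma bc_T_divP n (p : bc C) :
  (forall k, (k < n)%N -> p.1 k = 0 /\ p.2 k = 0) <-> exists q, p = bc_T ^+ n * q.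
Proof.
split=> [pn|[q ->]].
  have /fps_vanishP[a p1] k : (k < n)%N -> p.1 k = 0 by move=> /pn[].
  have /fps_vanishP[b p2] k : (k < n)%N -> p.2 k = 0 by move=> /pn[].
  exists (a, b); rewrite -[bc_T ^+ n]/(inC (fpsX C) ^+ n) -rmorphXn /=.
  by rewrite quadext_mulE /= !mul0r !mulr0 !addr0 -p1 -p2; case: (p).
have [a [b ->]] := bc_T_mulX n q => k kn /=.
by split; apply: (iffRL (fps_vanishP _ _)) kn; eexists.
Qed.

Lemma bc_T_nil : topnil bc_T.
Proof.
move=> _ [I [n [CI ->]]]; exists n => k kn.
have [|-> ->] := iffRL (bc_T_divP n (bc_T ^+ n)) _ k kn; first by exists 1; rewrite mulr1.
by split; apply: ct_nbhs0 CI.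
Qed.

Lemma bc_YE : bc_Y = - e w * (bc_T + (1 + e u) * bc_Y ^+ 2).
Proof.
have eE a : e a = inC (fpsC (ct_unit C a)) by [].
rewrite {1}/bc_Y {1}/bc_y fps_quadE -/(bc_y C) !eE /bc_T /bc_Y; ring.
Qed.

Lemma bc_Y_nil : topnil bc_Y.
Proof.
have yE : bc_y C = fpsX C * fps_shift (bc_y C).
  by rewrite {1}[bc_y C]fps_shiftE {1}/bc_y fps_quad0 rmorph0 add0r.
have -> : bc_Y = inC (fps_shift (bc_y C)) * bc_T.
  by have := congr1 inC yE; rewrite rmorphM mulrC.
exact/topnilM/bc_T_nil.
Qed.

Lemma bc_SE : inC (bc_s C) = e u + e j * e w * bc_Y.
Proof.
have eE a : e a = inC (fpsC (ct_unit C a)) by [].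
by rewrite !eE /bc_s /bc_Y; ring.
Qed.

Lemma bc_X2 : bc_X ^+ 2 = (e u + e j * e w * bc_Y) * bc_X + bc_T.
Proof. by rewrite -bc_SE; exact: quadextX2. Qed.

Lemma bc_pt_alg : is_point (e j) (1 + bc_X - e j * e w * bc_Q) bc_Y bc_Q.
Proof. exact: is_point_univ (ct_u2 _) (ct_juw _) _ _ _ bc_X2 bc_YE. Qed.

Lemma bc_pt_t : point_t (e u) (e w) (e j) (1 + bc_X - e j * e w * bc_Q) bc_Y bc_Q = bc_T.
Proof.
rewrite /point_t /point_x /point_s; transitivity (bc_X ^+ 2 - (e u + e j * e w * bc_Y) * bc_X).
  by ring.
by rewrite bc_X2; ring.
Qed.

Program Definition bc_pt : point (bc C) := Point bc_pt_alg bc_Y_nil _.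
Next Obligation.
set g := 1 + _ - _.
have -> : (g - 1) * (g - alpha_g (e u) (e w) (e j)) =
    bc_T + e j * e w * (1 + bc_Y) * bc_Y.
  rewrite -bc_pt_t (point_tE (ct_u2 _) (ct_juw _) bc_pt_alg) -/g; ring.
apply: topnilD; first exact: bc_T_nil.
exact/topnilM/bc_Y_nil.
Qed.

Lemma bc_pt_x : pt_x bc_pt = bc_X.
Proof. by rewrite /pt_x /point_x /=; ring. Qed.

Lemma bc_pt_T : pt_t bc_pt = bc_T.
Proof. exact: bc_pt_t. Qed.

Lemma bcE (p : bc C) : p = bc_inl C (p.1 0%N) + bc_inl C (p.2 0%N) * bc_X +
  bc_T * ((fps_shift p.1, fps_shift p.2) : bc C).
Proof.
case: p => a b /=; rewrite {1}[a]fps_shiftE {1}[b]fps_shiftE.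
by rewrite /bc_T !quadext_mulE; congr (_, _); rewrite /=; ring.
Qed.

End UniversalPoint.

(** Equality of all components would be too strong: [bc_ext] sends [bc_Y] to an element known to
    agree with the y of the given point only after multiplication by j. *)
Definition pt_eq (D : ctalg A) (p p' : point D) :=
  [/\ point_g p = point_g p', ct_unit D j * point_y p = ct_unit D j * point_y p'
    & ct_unit D j * point_q p = ct_unit D j * point_q p'].

Lemma pt_eq_refl (D : ctalg A) (p : point D) : pt_eq p p.
Proof. by split. Qed.

Lemma pt_eq_trans (D : ctalg A) (p p' p'' : point D) :
  pt_eq p p' -> pt_eq p' p'' -> pt_eq p p''.
Proof. by move=> [h1 h2 h3] [k1 k2 k3]; split; rewrite ?h1 ?h2 ?h3. Qed.

Lemma pt_eq_sym (D : ctalg A) (p p' : point D) : pt_eq p p' -> pt_eq p' p.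
Proof. by move=> [h1 h2 h3]; split. Qed.

Lemma pt_eq_x (D : ctalg A) (p p' : point D) : pt_eq p p' -> pt_x p = pt_x p'.
Proof.
by move=> [h _ h2]; rewrite /pt_x /point_x h -!mulrA ![ct_unit D w * _]mulrC !mulrA h2.
Qed.

Lemma pt_eq_t (D : ctalg A) (p p' : point D) : pt_eq p p' -> pt_t p = pt_t p'.
Proof.
move=> h; rewrite /pt_t (pt_eq_x h); case: h => _ h _; congr (_ * (_ - _)).
by rewrite /pt_s /point_s -!mulrA ![ct_unit D w * _]mulrC !mulrA h.
Qed.

Lemma pt_eq_map (D E : ctalg A) (f : cthom D E) (p p' : point D) :
  pt_eq p p' -> pt_eq (pt_map f p) (pt_map f p').
Proof.
move=> [h1 h2 h3]; split; rewrite /= ?h1 // -!(cth_unit f) -!rmorphM ?h2 ?h3 //.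
Qed.

Lemma pt_map_comp (D E F : ctalg A) (g : cthom E F) (f : cthom D E) p :
  pt_eq (pt_map (cth_comp g f) p) (pt_map g (pt_map f p)).
Proof. by split. Qed.

(** * Homomorphisms out of the base change *)

Section Extension.
Variables (C D : ctalg A) (f : cthom C D) (p : point D).
Local Notation e := (ct_unit D).

Let ev : {rmorphism fps C -> D} := fps_eval f (pt_t_nil p).

Let evC c : ev (fpsC c) = f c. Proof. exact: fps_evalC. Qed.

Let y0 := ev (bc_y C).

Let y0E : y0 = - e w * (pt_t p + (1 + e u) * y0 ^+ 2).
Proof.
rewrite {1}/y0 /bc_y fps_quadE -/(bc_y C) rmorphM rmorphD rmorphM rmorphXn /=.
rewrite !evC [ev _](fps_evalX f (pt_t_nil p)) rmorphN rmorphD rmorph1.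
by rewrite !(cth_unit f).
Qed.

Let y0_nil : topnil y0.
Proof.
rewrite /y0 /bc_y [fps_quad _ _]fps_shiftE fps_quad0 rmorph0 add0r rmorphM.
by rewrite [ev (fpsX C)](fps_evalX f (pt_t_nil p)) mulrC; apply/topnilM/pt_t_nil.
Qed.

(* Both y and y0 are small solutions of the same quadratic equation, up to the
   annihilator of j, and the difference of two such is killed by a unit. *)
Let jy0 : e j * y0 = e j * point_y p.
Proof.
set y := point_y p.
have jy : e j * y = e j * (- e w * (pt_t p + (1 + e u) * y ^+ 2)).
  exact: point_quad (ct_u2 _) (ct_juw _) _ _ _ (pointP p).
have [d d1] := topnil_inv (topnilM (e w * (1 + e u)) (topnilD y0_nil (@point_y_nil _ p))).
rewrite -/y in d1; set v := e w * _ * _ in d1.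
have : (1 + v) * (e j * y0 - e j * y) = 0.
  have -> : (1 + v) * (e j * y0 - e j * y) =
    (e j * y0 - e j * (- e w * (pt_t p + (1 + e u) * y0 ^+ 2))) -
    (e j * y - e j * (- e w * (pt_t p + (1 + e u) * y ^+ 2))) by rewrite /v; ring.
  by rewrite -y0E -jy !subrr.
move=> /(congr1 ( *%R d)); rewrite mulrA d1 mul1r mulr0 => /eqP.
by rewrite subr_eq0 => /eqP.
Qed.

Let x2 : pt_x p ^+ 2 = ev (bc_s C) * pt_x p + ev (fpsX C).
Proof.
rewrite [ev (fpsX C)](fps_evalX f (pt_t_nil p)).
have -> : ev (bc_s C) = pt_s p.
  rewrite /bc_s rmorphD rmorphM !evC rmorphM !(cth_unit f) -/y0.
  by rewrite /pt_s /point_s mulrAC jy0 mulrAC.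
by rewrite /pt_t; ring.
Qed.

Program Definition bc_ext : cthom (bc C) D := @CTHom _ (bc C) D (quadext_hom x2) _ _.
Next Obligation.
move=> a; rewrite -[LHS]/(ev (fpsC (ct_unit C a)) + ev 0 * pt_x p).
by rewrite rmorph0 mul0r addr0 evC cth_unit.
Qed.
Next Obligation.
move=> J DJ; have [n Jn] := pt_t_nil p DJ; have [I CI IJ] := cth_continuous f DJ.
have JI := ct_ideal DJ.
have evJ a : (forall k, (k < n)%N -> I (a k)) -> J (ev a).
  move=> Ia; rewrite -[ev a](subrK (fps_psum f (pt_t p) n a)).
  apply: idealD => //; first exact: fps_evalP.
  apply: (big_ind J); [exact: ideal0|exact: idealD|move=> i _].
  by apply: idealMr => //; apply/IJ/Ia.
exists (bc_nbhd I n); first by exists I, n.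
move=> b Ib; apply: idealD => //; last apply: idealMr => //.
  by apply: evJ => k /Ib[].
by apply: evJ => k /Ib[].
Qed.

Lemma bc_ext_inl c : bc_ext (bc_inl C c) = f c.
Proof.
rewrite -[LHS]/(ev (fpsC c) + ev 0 * pt_x p).
by rewrite rmorph0 mul0r addr0 evC.
Qed.

Lemma bc_ext_X : bc_ext (bc_X C) = pt_x p.
Proof.
rewrite -[LHS]/(ev 0 + ev 1 * pt_x p).
by rewrite rmorph0 rmorph1 mul1r add0r.
Qed.

Lemma bc_ext_pt : pt_eq (pt_map bc_ext (bc_pt C)) p.
Proof.
have jY : e j * bc_ext (bc_Y C) = e j * point_y p.
  rewrite -[bc_ext _]/(y0 + ev 0 * pt_x p).
  by rewrite rmorph0 mul0r addr0.
(* At every point j (x - y) = j u q, and w turns j u into j. *)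
have jQ : e j * bc_ext (bc_Q C) = e j * point_q p.
  rewrite /bc_Q rmorphM rmorphB bc_ext_X cth_unit mulrCA mulrBr jY.
  have [_ jg] := pointP p.
  transitivity (e w * (e j * point_g p + e j * (e j * e w * point_q p)
    - e j - e j * point_y p)); first by rewrite /pt_x /point_x; ring.
  rewrite jg; transitivity (- 2%:R * e w * e j * point_q p
    + e w * (e j * e j * e w) * point_q p); first by ring.
  rewrite (jjw (ct_u2 _) (ct_juw _)); ring: (ct_juw D).
split=> //=.
have -> : bc_ext (1 + bc_X C - ct_unit (bc C) j * ct_unit (bc C) w * bc_Q C) =
  1 + pt_x p - e w * (e j * bc_ext (bc_Q C)).
  by rewrite rmorphB rmorphD rmorph1 !rmorphM bc_ext_X !cth_unit; ring.
by rewrite jQ /pt_x /point_x; ring.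
Qed.

End Extension.

(** Both maps agree on C, x and t. By [bcE] the difference at an element is the image of t times the
    difference at its shift; iterated, this puts it in every neighbourhood. *)
Lemma bc_hom_eq (C D : ctalg A) (f g : cthom (bc C) D) :
  f \o bc_inl C =1 g \o bc_inl C ->
  pt_eq (pt_map f (bc_pt C)) (pt_map g (bc_pt C)) -> f =1 g.
Proof.
move=> fgC fgp.
have fgX : f (bc_X C) = g (bc_X C) by rewrite -bc_pt_x !pt_map_x (pt_eq_x fgp).
have fgT : f (bc_T C) = g (bc_T C) by rewrite -bc_pt_T !pt_map_t (pt_eq_t fgp).
have key n p : exists r, f p - g p = g (bc_T C) ^+ n * r.
  elim: n p => [|n IH] p; first by exists (f p - g p); rewrite mul1r.
  have [r er] := IH ((fps_shift p.1, fps_shift p.2) : bc C); exists r.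
  rewrite exprS -mulrA -er {1 2}[p]bcE !rmorphD !rmorphM /= fgX fgT.
  have := fgC (p.1 0%N); have := fgC (p.2 0%N) => /= -> ->.
  by ring.
move=> p; apply: ct_separated => J DJ.
have [n Jn] := topnil_hom g (bc_T_nil (C := C)) DJ.
by have [r ->] := key n p; apply: idealMr => //; apply: ct_ideal.
Qed.

Local Notation bc0 := (bc (ct_disc A)).

Lemma bc0_hom_eq (D : ctalg A) (f g : cthom bc0 D) :
  pt_eq (pt_map f (bc_pt (ct_disc A))) (pt_map g (bc_pt (ct_disc A))) -> f =1 g.
Proof.
move=> h; apply: bc_hom_eq => // a.
exact: etrans (cth_unit f a) (esym (cth_unit g a)).
Qed.

Definition bc0_ext (D : ctalg A) (p : point D) : cthom bc0 D := bc_ext (ct_eta D) p.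

Lemma bc0_ext_pt (D : ctalg A) (p : point D) :
  pt_eq (pt_map (bc0_ext p) (bc_pt (ct_disc A))) p.
Proof. exact: bc_ext_pt. Qed.

(** A homomorphism from [bc0] amounts to a point, so a pair (f, g) is f together with a point of D,
    the data that [bc_ext] takes. *)
Program Definition bc_tensor (C : ctalg A) : cttensor C bc0 :=
  @CTTensor A C bc0 (bc C) (bc_inl C) (bc0_ext (bc_pt C))
   (fun D f g => bc_ext f (pt_map g (bc_pt (ct_disc A)))) _ _ _.
Next Obligation. by move=> C D f g c; apply: bc_ext_inl. Qed.
Next Obligation.
move=> C D f g; apply: (bc0_hom_eq (f := cth_comp _ _)).
apply: pt_eq_trans (pt_map_comp _ _ _) _.
exact: pt_eq_trans (pt_eq_map _ (bc0_ext_pt (bc_pt C))) (bc_ext_pt f _).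
Qed.
Next Obligation.
move=> C D h k hk1 hk2; apply: bc_hom_eq; first exact: hk1.
have h2 (l : cthom (bc C) D) : pt_eq (pt_map l (bc_pt C))
    (pt_map (cth_comp l (bc0_ext (bc_pt C))) (bc_pt (ct_disc A))).
  apply: pt_eq_sym; apply: pt_eq_trans (pt_map_comp _ _ _) _.
  exact: pt_eq_map (bc0_ext_pt (bc_pt C)).
apply: (pt_eq_trans (h2 h)); apply: (fun H => pt_eq_trans H (pt_eq_sym (h2 k))).
by split; [|congr (_ * _)|congr (_ * _)]; apply: hk2.
Qed.

(** * The group of points and the Hopf algebra structure *)

Section PointGroup.
Variable D : ctalg A.
Implicit Types p q r : point D.

Lemma pt_eq_mul p p' r r' :
  pt_eq p p' -> pt_eq r r' -> pt_eq (pt_mul p r) (pt_mul p' r').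
Proof.
move=> [g1 y1 q1] [g2 y2 q2].
split; rewrite /= ?g1 ?g2 // /point_mul_y /point_mul_q.
  transitivity (ct_unit D j * point_y p' * (1 + point_y r) + ct_unit D j * point_y r).
    by rewrite -y1; ring.
  transitivity (ct_unit D j * point_y r * (1 + point_y p') + ct_unit D j * point_y p').
    by ring.
  by rewrite y2; ring.
transitivity (ct_unit D j * point_q p * (1 + point_y r - 2%:R * point_q r)
    + ct_unit D j * point_y p * point_q r + ct_unit D j * point_q r); first by ring.
rewrite q1 y1 q2.
transitivity (ct_unit D j * point_y r * point_q p' - 2%:R * (ct_unit D j * point_q r) * point_q p'
    + ct_unit D j * point_q r * (1 + point_y p') - ct_unit D j * point_q r
    + ct_unit D j * point_q r' + ct_unit D j * point_q p'); first by ring.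
by rewrite y2 q2; ring.
Qed.

Lemma pt_mulA p q r : pt_eq (pt_mul (pt_mul p q) r) (pt_mul p (pt_mul q r)).
Proof. by split; rewrite /= /point_mul_q /point_mul_y; ring. Qed.

Lemma pt_mulC p q : pt_eq (pt_mul p q) (pt_mul q p).
Proof. by split; rewrite /= /point_mul_q /point_mul_y; ring. Qed.

Lemma pt_mul1 p : pt_eq (pt_mul (pt_one D) p) p.
Proof. by split; rewrite /= /point_mul_q /point_mul_y; ring. Qed.

Lemma pt_mul_alpha2 : pt_eq (pt_mul (pt_alpha D) (pt_alpha D)) (pt_one D).
Proof.
split; rewrite /= /point_mul_q /point_mul_y; try ring.
by rewrite -expr2 (alpha_sqr (ct_u2 D) (ct_juw D)).
Qed.

Definition pt_inv p : point D := projT1 (cid (pt_inv_ex p)).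

Lemma pt_mulV p : pt_eq (pt_mul (pt_inv p) p) (pt_one D).
Proof.
have := projT2 (cid (pt_inv_ex p)); rewrite -/(pt_inv p) => -[yi [h1 h2 h3 h4]].
have [q2 _] := pointP p.
split; rewrite /= ?h1 // /point_mul_q /point_mul_y h3 ?h4.
  transitivity (ct_unit D j * (yi * (1 + point_y p) - 1)); first by ring.
  by rewrite h2; ring.
transitivity (yi * (yi * (1 + point_y p) + 1) * (ct_unit D j * point_q p)
  - 2%:R * yi ^+ 2 * (ct_unit D j * point_q p ^+ 2)); first by ring.
rewrite q2; transitivity (ct_unit D j * yi * point_q p * (1 - yi * (1 + point_y p))).
  by ring.
by rewrite h2; ring.
Qed.

End PointGroup.

Lemma pt_map_mul (D E : ctalg A) (f : cthom D E) (p q : point D) :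
  pt_eq (pt_map f (pt_mul p q)) (pt_mul (pt_map f p) (pt_map f q)).
Proof. by split; rewrite /= /point_mul_q /point_mul_y; ring. Qed.

Lemma pt_map_eq (D E : ctalg A) (f g : cthom D E) (p : point D) :
  f =1 g -> pt_eq (pt_map f p) (pt_map g p).
Proof. by move=> fg; split; rewrite /= !fg. Qed.

Lemma pt_map_id (D : ctalg A) (p : point D) : pt_eq (pt_map (cth_id D) p) p.
Proof. by split. Qed.

Lemma pt_map_one (D E : ctalg A) (f : cthom D E) :
  pt_eq (pt_map f (pt_one D)) (pt_one E).
Proof. by split; rewrite /= ?rmorph1 ?rmorph0. Qed.

Lemma pt_map_alpha (D E : ctalg A) (f : cthom D E) :
  pt_eq (pt_map f (pt_alpha D)) (pt_alpha E).
Proof.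
split; rewrite /= ?rmorph1 ?rmorph0 //.
by rewrite /alpha_g -!(cth_unit f); ring.
Qed.

Definition bc00 : cttensor bc0 bc0 := bc_tensor bc0.
Definition bc000 : cttensor bc00 bc0 := bc_tensor bc00.
Definition pt0 : point bc0 := bc_pt (ct_disc A).

Definition bc_psi : cthom bc0 bc00 :=
  bc0_ext (pt_mul (pt_map (ctt_in1 bc00) pt0) (pt_map (ctt_in2 bc00) pt0)).

(** In terms of points, psi is the product. Through this lemma each Hopf axiom becomes an identity
    in the group of points. *)
Lemma copair_psi (D : ctalg A) (f g : cthom bc0 D) :
  pt_eq (pt_map (cth_comp (ctt_copair bc00 f g) bc_psi) pt0)
        (pt_mul (pt_map f pt0) (pt_map g pt0)).
Proof.
apply: pt_eq_trans (pt_map_comp _ _ _) _.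
apply: pt_eq_trans (pt_eq_map _ (bc0_ext_pt _)) _.
apply: pt_eq_trans (pt_map_mul _ _ _) _.
apply: pt_eq_mul; apply: pt_eq_trans (pt_eq_sym (pt_map_comp _ _ _)) _.
  exact/pt_map_eq/ctt_copair1.
exact/pt_map_eq/ctt_copair2.
Qed.

Lemma bc_psi_pt : pt_eq (pt_map bc_psi pt0)
  (pt_mul (pt_map (ctt_in1 bc00) pt0) (pt_map (ctt_in2 bc00) pt0)).
Proof. exact: bc0_ext_pt. Qed.

Program Definition bc_hopf : hopf A :=
  @Hopf A bc0 bc00 bc000 bc_psi (bc0_ext (pt_one (ct_disc A)))
    (bc0_ext (pt_inv pt0)) _ _ _ _.
Next Obligation.
apply: (bc0_hom_eq (f := cth_comp _ _) (g := cth_comp _ _)).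
pose i12 : cthom bc00 bc000 := ctt_in1 bc000.
pose i1 := cth_comp i12 (ctt_in1 bc00); pose i2 := cth_comp i12 (ctt_in2 bc00).
pose i3 : cthom bc0 bc000 := ctt_in2 bc000.
have L : pt_eq (pt_map (cth_comp i12 bc_psi) pt0)
    (pt_mul (pt_map i1 pt0) (pt_map i2 pt0)).
  apply: pt_eq_trans (pt_map_comp _ _ _) _.
  apply: pt_eq_trans (pt_eq_map _ bc_psi_pt) _.
  apply: pt_eq_trans (pt_map_mul _ _ _) _.
  by apply: pt_eq_mul; apply/pt_eq_sym/pt_map_comp.
have R : pt_eq (pt_map (cth_comp (ctt_copair bc00 i2 i3) bc_psi) pt0)
  (pt_mul (pt_map i2 pt0) (pt_map i3 pt0)) by exact: copair_psi.
apply: pt_eq_trans (copair_psi _ _) _.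
apply: pt_eq_trans (pt_eq_mul L (pt_eq_refl _)) _.
apply: pt_eq_trans (pt_mulA _ _ _) _.
apply: pt_eq_sym; apply: pt_eq_trans (copair_psi _ _) _.
exact: pt_eq_mul (pt_eq_refl _) R.
Qed.
Next Obligation.
apply: (bc0_hom_eq (f := cth_comp _ _) (g := cth_id _)).
apply: pt_eq_trans (copair_psi _ _) _.
apply: (fun H => pt_eq_trans (pt_eq_mul H (pt_map_id _)) (pt_mul1 _)).
apply: pt_eq_trans (pt_map_comp _ _ _) _.
apply: pt_eq_trans (pt_eq_map _ (bc0_ext_pt _)) _.
exact: pt_map_one.
Qed.
Next Obligation.
apply: (bc0_hom_eq (f := cth_comp _ _)).
apply: pt_eq_trans (copair_psi _ _) _.
apply: pt_eq_trans (pt_mulC _ _) _.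
exact: pt_eq_sym bc_psi_pt.
Qed.
Next Obligation.
apply: (bc0_hom_eq (f := cth_comp _ _) (g := cth_comp _ _)).
apply: pt_eq_trans (copair_psi _ _) _.
apply: pt_eq_trans (pt_eq_mul (bc0_ext_pt _) (pt_map_id _)) _.
apply: pt_eq_trans (pt_mulV _) _; apply: pt_eq_sym.
apply: pt_eq_trans (pt_map_comp _ _ _) _.
apply: pt_eq_trans (pt_eq_map _ (bc0_ext_pt _)) _.
exact: pt_map_one.
Qed.

(** * The equivariant formal group law *)

Definition bc_theta (c : bool) : cthom bc_hopf (ct_disc A) :=
  bc0_ext (if c then pt_alpha (ct_disc A) else pt_one (ct_disc A)).

Lemma bc_theta_hom : hopf_hom_dual bc_theta.
Proof.
split=> // c d; apply: (bc0_hom_eq (f := cth_comp _ _)).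
apply: pt_eq_trans (copair_psi _ _) _.
apply: pt_eq_trans (pt_eq_mul (bc0_ext_pt _) (bc0_ext_pt _)) _; apply: pt_eq_sym.
apply: pt_eq_trans (bc0_ext_pt _) _; apply: pt_eq_sym.
case: c d => -[] /=; try exact: pt_mul1.
  exact: pt_mul_alpha2.
by apply: pt_eq_trans (pt_mulC _ _) _; apply: pt_mul1.
Qed.

Local Notation X := (bc_X (ct_disc A)).
Local Notation T := (bc_T (ct_disc A)).
Local Notation e := (ct_unit bc0).
Local Notation h := (alpha_g (e u) (e w) (e j)).

Lemma bc0_TE : T = X * (X - pt_s pt0).
Proof. by rewrite -bc_pt_T /pt_t bc_pt_x. Qed.

(** As x (a + b x) = t b + (a + s b) x and t is regular in A[[t]], first b and then a vanishes. *)
Lemma bc0_regular (b : bc_hopf) : (X : bc_hopf) * b = 0 -> b = 0.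
Proof.
case: b => a b; rewrite quadext_mulE /= => -[].
rewrite !mul0r !mul1r !add0r => /fpsX_regular ->.
by rewrite mulr0 addr0 => ->.
Qed.

Lemma bc_theta_X c : bc_theta c X = if c then u else 0.
Proof.
rewrite bc_ext_X; case: c; rewrite /pt_x /point_x /= /alpha_g /=; ring.
Qed.

(** By [bcE], and because x divides t, an element is a constant plus a multiple of x; theta reads
    off the constant. *)
Lemma bc0_kernel (b : bc_hopf) :
  bc_theta false b = 0 <-> exists b' : bc_hopf, b = (X : bc_hopf) * b'.
Proof.
have tX : bc_theta false X = 0 by exact: bc_theta_X.
split=> [|[b' ->]]; last by rewrite rmorphM tX mul0r.
rewrite [b]bcE; set r := bc_inl _ _; set r' := bc_inl _ _.
have tr : bc_theta false r = b.1 0%N by exact: bc_ext_inl.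
rewrite bc0_TE !rmorphD !rmorphM tX mulr0 !mul0r !addr0 tr => b0.
exists (r' + (X - pt_s pt0) * ((fps_shift b.1, fps_shift b.2) : bc_hopf)).
by rewrite /r b0 rmorph0 add0r; ring.
Qed.

Lemma bc0_translate : translate bc_theta true X = h * (X - pt_s pt0).
Proof.
have P := copair_psi (cth_id bc0) (cth_comp (ct_eta bc0) (bc_theta true)).
have {}P : pt_eq (pt_map (cth_comp (ctt_copair bc00 (cth_id bc0)
    (cth_comp (ct_eta bc0) (bc_theta true))) bc_psi) pt0) (pt_mul pt0 (pt_alpha bc0)).
  apply: pt_eq_trans P _; apply: pt_eq_mul; first exact: pt_map_id.
  apply: pt_eq_trans (pt_map_comp _ _ _) _.
  apply: pt_eq_trans (pt_eq_map _ (bc0_ext_pt _)) _.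
  exact: pt_map_alpha.
transitivity (pt_x (pt_mul pt0 (pt_alpha bc0))).
  by rewrite -(pt_eq_x P) -pt_map_x bc_pt_x.
rewrite -bc_pt_x.
exact: point_x_mul_alpha (ct_u2 _) (ct_juw _) _ _ _.
Qed.

(** The product of x and its translate is h t with h^2 = 1, and over the discrete A the
    neighbourhoods are the ideals generated by powers of t. *)
Lemma bc0_topology :
  @principal_topology A bc_hopf ((X : bc_hopf) * translate bc_theta true X).
Proof.
have -> : (X : bc_hopf) * translate bc_theta true X = h * T.
  by rewrite bc0_translate bc0_TE; ring.
have h2 := alpha_sqr (ct_u2 bc0) (ct_juw bc0).
split=> [I BI|n].
  have [n In] := topnilM h (bc_T_nil (C := ct_disc A)) BI; exists n => b.
  by apply: idealMr => //; apply: ct_ideal BI.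
exists (bc_nbhd [set 0] n); first by exists [set 0], n.
move=> b /bc_T_divP[q ->]; exists (h ^+ n * q).
by rewrite exprMn mulrACA -exprMn -expr2 h2 expr1n mul1r.
Qed.

Definition bc_efgl : efgl A :=
  @EFGL A bc_hopf bc_theta X bc_theta_hom bc0_regular bc0_kernel bc0_topology.

Local Notation Y := (bc_Y (ct_disc A)).
Local Notation Q := (bc_Q (ct_disc A)).
Local Notation th := (bc_theta true).

(* Up to the annihilator of j, K inverts x on the support of q. *)
Lemma bc0_K_ex : exists k : bc0, k * (1 + e w * (1 + e u) * Y) = e w.
Proof.
have [d d1] := topnil_inv (topnilM (e w * (1 + e u)) (bc_Y_nil (C := ct_disc A))).
by exists (e w * d); rewrite -mulrA d1 mulr1.
Qed.

Lemma bc_theta_Q : j * th Q = j.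
Proof. by have [_ _] := bc0_ext_pt (pt_alpha (ct_disc A)); rewrite /= mulr1. Qed.

Lemma bc_theta_Y : j * th Y = 0.
Proof. by have [_ + _] := bc0_ext_pt (pt_alpha (ct_disc A)); rewrite /= mulr0. Qed.

Lemma bc_theta_unit c a : bc_theta c (e a) = a.
Proof. exact: cth_unit. Qed.

Local Notation i1 := (ctt_in1 bc00).
Local Notation i2 := (ctt_in2 bc00).

Section ResidualDivision.
Variable K : bc0.
Hypothesis KE : K * (1 + e w * (1 + e u) * Y) = e w.

Lemma bc0_jQK n : e j * Q = X ^+ n * (e j * K ^+ n * Q).
Proof.
rewrite -bc_pt_x.
exact: (point_q_div (ct_u2 _) (ct_juw _) n (bc_pt_alg (ct_disc A)) KE).
Qed.

(** The value of y at alpha is killed by j, so there the equation for K reduces to K = w. *)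
Lemma bc_theta_K : j * th K = j * w.
Proof.
have := congr1 th KE; rewrite rmorphM rmorphD rmorph1 !rmorphM rmorphD rmorph1.
rewrite !bc_theta_unit => H; transitivity (j * (th K * (1 + w * (1 + u) * th Y))); last by rewrite H.
transitivity (th K * (j + w * (1 + u) * (j * th Y))); last by ring.
by rewrite bc_theta_Y; ring.
Qed.

Lemma bc_theta_jKQ n : th (e j * K ^+ n * Q ^+ 2) = j * w ^+ n.
Proof.
have -> : th (e j * K ^+ n * Q ^+ 2) = j * th K ^+ n * th Q ^+ 2 :> A.
  by rewrite !rmorphM !rmorphXn bc_theta_unit.
elim: n => [|n IH].
  transitivity (j * th Q * th Q); first by ring.
  by rewrite !bc_theta_Q; ring.
transitivity (th K * (j * th K ^+ n * th Q ^+ 2)); first by rewrite exprS; ring.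
rewrite IH; transitivity (w ^+ n * (j * th K)); first by ring.
by rewrite bc_theta_K exprS; ring.
Qed.

(** The correction term in psi(x) lies in every power of the ideal of x_1. It is therefore invisible
    both to the underlying formal group law and to the expansion in x_1. *)
Lemma bc_psi_jQ n : ct_unit bc00 j * (i1 Q * i2 Q) =
  i1 X ^+ n * (i1 (e j * K ^+ n * Q) * i2 Q).
Proof.
rewrite -(cth_unit i1) mulrA -rmorphM {1}(bc0_jQK n).
by rewrite rmorphM rmorphXn mulrA.
Qed.

End ResidualDivision.

Lemma bc_psi_X : bc_psi X =
  i1 X + i2 X + i1 X * i2 X - ct_unit bc00 j * (i1 Q * i2 Q).
Proof.
rewrite -(bc_pt_x (ct_disc A)) !pt_map_x (pt_eq_x bc_psi_pt).
exact: pt_mulx.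
Qed.

Lemma bc_efgl_euler : euler_class bc_efgl = u.
Proof. exact: (bc_theta_X true). Qed.

Lemma bc_efgl_two : efgl_two_x bc_efgl = 2%:R * X + X ^+ 2 - e j * Q ^+ 2.
Proof.
have P : pt_eq (pt_map (cth_comp (ctt_copair bc00 (cth_id bc0) (cth_id bc0))
    bc_psi) pt0) (pt_mul pt0 pt0).
  by apply: pt_eq_trans (copair_psi _ _) _; apply: pt_eq_mul; apply: pt_map_id.
transitivity (pt_x (pt_mul pt0 pt0)).
  by rewrite -(pt_eq_x P) -pt_map_x bc_pt_x.
rewrite (pt_mulx pt0 pt0) bc_pt_x -[point_q pt0]/Q; ring.
Qed.

Lemma bc_efgl_underlying : efgl_underlying bc_efgl (mult_law 1).
Proof.
move=> n; rewrite /efgl_psi_x -[hopf_psi _ _]/(bc_psi X) bc_psi_X.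
have [K KE] := bc0_K_ex; rewrite (bc_psi_jQ KE n).
move: (i1 (e j * K ^+ n * Q) * i2 Q) => r.
exact: (mult_law_rem (ct_unit bc00) (i1 X) (i2 X) n r).
Qed.

Lemma bc_efgl_expansion : @efgl_expansion _ bc_efgl (mult_coef X).
Proof.
move=> n; rewrite /efgl_psi_x -[hopf_psi _ _]/(bc_psi X) bc_psi_X.
have [K KE] := bc0_K_ex; rewrite (bc_psi_jQ KE n).
move: (i1 (e j * K ^+ n * Q) * i2 Q) => r.
exact: (mult_coef_rem i2 (i1 X) X n r).
Qed.

End BaseChange.

(** * The coefficients of the equivariant formal group law *)

Section Remainders.
Variables (A : comPzRingType) (E : efgl A).
Local Notation x := (efgl_x E).

Lemma efgl_theta_unit c a : efgl_theta E c (ct_unit E a) = a.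
Proof. exact: cth_unit. Qed.

Lemma efgl_theta_x : efgl_theta E false x = 0.
Proof. by apply/efgl_kernel; exists 1; rewrite mulr1. Qed.

(** Regularity of x makes k the only possible quotient, so [xget] returns it and not its default
    0. *)
Lemma efgl_remS a k n : efgl_rem n.+1 (ct_unit E a + x * k) = efgl_rem n k.
Proof.
rewrite /efgl_rem iterSr; congr (iter _ _ _).
have -> : efgl_theta E false (ct_unit E a + x * k) = a.
  by rewrite rmorphD rmorphM efgl_theta_x mul0r addr0 efgl_theta_unit.
apply: xget_unique => //= l /addrI /eqP; rewrite -subr_eq0 -mulrBr => /eqP.
by move=> /efgl_regular /eqP; rewrite subr_eq0 eq_sym => /eqP.
Qed.

Lemma efgl_rem0 n : efgl_rem n (0 : E) = 0.
Proof.
elim: n => // n IH.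
by rewrite -{2}IH -(efgl_remS 0 0 n) rmorph0 mulr0 addr0.
Qed.

End Remainders.

Section TwoSeries.
Variables (A : comPzRingType) (E : efgl A) (u w j : A) (K Q : E).
Hypotheses (u2 : u ^+ 2 = j - 2%:R * u) (juw : j * u * w = j).
Local Notation x := (efgl_x E).
Local Notation e := (ct_unit E).
Local Notation th := (efgl_theta E true).
Hypothesis two : efgl_two_x E = 2%:R * x + x ^+ 2 - e j * Q ^+ 2.
Hypothesis jQ : e j * Q = x * (e j * K * Q).
Hypothesis th_x : th x = u.
Hypothesis th_jKQ : forall n, th (e j * K ^+ n * Q ^+ 2) = j * w ^+ n.

(** The [match] lists the values at alpha of the successive remainders of 2 x + x^2. The other term
    comes from j q^2: each division by x contributes a factor K, whose value at alpha acts as w. *)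
Definition coef_q (k : nat) : A :=
  (match k with 0 => j | 1 => 2%:R + u | 2 => 1 | _ => 0 end) - j * w ^+ k.

Lemma efgl_two_rem k : th (efgl_rem k (efgl_two_x E)) = coef_q k.
Proof.
have xx n := div_step n jQ.
have r0 : efgl_two_x E = e 0 + x * (2%:R + x - e j * K ^+ 1 * Q ^+ 2).
  by rewrite two rmorph0 mulrBr -xx; ring.
have r1 : 2%:R + x - e j * K ^+ 1 * Q ^+ 2 =
    e 2%:R + x * (1 - e j * K ^+ 2 * Q ^+ 2).
  by rewrite mulrBr -xx rmorph_nat; ring.
have r2 : 1 - e j * K ^+ 2 * Q ^+ 2 = e 1 + x * (- (e j * K ^+ 3 * Q ^+ 2)).
  by rewrite mulrN -xx rmorph1.
have r3 n m : th (efgl_rem n (- (e j * K ^+ m * Q ^+ 2))) = - (j * w ^+ (m + n)).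
  elim: n m => [|n IH] m; first by rewrite addn0 -th_jKQ; exact: rmorphN.
  have -> : - (e j * K ^+ m * Q ^+ 2) = e 0 + x * (- (e j * K ^+ m.+1 * Q ^+ 2)).
    by rewrite rmorph0 add0r mulrN -xx.
  by rewrite efgl_remS IH addSnnS.
have th0 : th (efgl_two_x E) = 2%:R * u + u ^+ 2 - j.
  have := th_jKQ 0; rewrite !expr0 !mulr1 => th_jQ.
  rewrite two rmorphB th_jQ -th_x rmorphD rmorphXn.
  by rewrite [th (2%:R * x)]rmorphM rmorph_nat.
have th1 : th (2%:R + x - e j * K ^+ 1 * Q ^+ 2) = 2%:R + u - j * w ^+ 1.
  by rewrite rmorphB th_jKQ -th_x rmorphD rmorph_nat.
have th2 : th (1 - e j * K ^+ 2 * Q ^+ 2) = 1 - j * w ^+ 2.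
  by rewrite rmorphB th_jKQ rmorph1.
case: k => [|k]; first by rewrite [efgl_rem _ _]/= th0 u2 /coef_q; ring.
rewrite r0 efgl_remS; case: k => [|k]; first by rewrite [efgl_rem _ _]/= th1.
rewrite r1 efgl_remS; case: k => [|k]; first by rewrite [efgl_rem _ _]/= th2.
by rewrite r2 efgl_remS r3 /coef_q sub0r.
Qed.

End TwoSeries.

Section Coefficients.
Variables (A : comPzRingType) (u w j : A).
Hypotheses (u2 : u ^+ 2 = j - 2%:R * u) (juw : j * u * w = j).
Local Notation E := (bc_efgl u2 juw).
Local Notation th := (bc_theta u2 juw true).

(** The remainders of f_1 = 1 + x are 1 + x, 1, 0, ..., taken here at alpha; f_i = 0 for i > 1. *)
Definition coef_b (i k : nat) : A :=
  match i, k with 1, 0 => 1 + u | 1, 1 => 1 | _, _ => 0 end.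

Lemma bc_efgl_b i k : (1 <= i)%N ->
  efgl_theta E true (efgl_rem k (mult_coef (efgl_x E) i)) = coef_b i k.
Proof.
case: i => [//|[|i]] _; last by rewrite efgl_rem0 rmorph0; case: k => [|[]].
have f1 : mult_coef (efgl_x E) 1 = ct_unit E 1 + efgl_x E * 1 by rewrite rmorph1 mulr1.
case: k => [|k]; first by rewrite rmorphD rmorph1 [X in _ + X]bc_theta_X.
rewrite f1 efgl_remS.
have -> : 1 = ct_unit E 1 + efgl_x E * 0 by rewrite rmorph1 mulr0 addr0.
case: k => [|k]; first by rewrite mulr0 addr0 [LHS]efgl_theta_unit.
by rewrite efgl_remS efgl_rem0 rmorph0.
Qed.

Lemma bc_efgl_q k :
  efgl_theta E true (efgl_rem k (efgl_two_x E)) = coef_q u w j k.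
Proof.
have [K KE] := bc0_K_ex u w j.
apply: (@efgl_two_rem A E u w j K (bc_Q u w j (ct_disc A)) u2).
- exact: bc_efgl_two.
- by have := bc0_jQK u2 juw KE 1; rewrite !expr1.
- exact: (bc_theta_X u2 juw true).
- by move=> n; exact: bc_theta_jKQ.
Qed.

End Coefficients.

(** * Hilbert's basis theorem *)

(* Quantifying over the ideals containing G avoids linear combinations. *)
Definition fin_gen (R : comPzRingType) (I : set R) : Prop :=
  exists G : seq R, (forall g, g \in G -> I g) /\
    forall J : set R, is_ideal J -> (forall g, g \in G -> J g) -> I `<=` J.

Lemma noetherianP (R : comPzRingType) :
  noetherian R <-> forall I : set R, is_ideal I -> fin_gen I.
Proof.
split=> [N I II|N I II].
  have [n [g Ig]] := N I II; exists [seq g i | i <- enum 'I_n]; split.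
    move=> _ /mapP[i _ ->]; rewrite Ig /=; exists (fun k => (k == i)%:R).
    rewrite (bigD1 i) //= eqxx mul1r big1 ?addr0 // => k /negbTE->.
    by rewrite mul0r.
  move=> J JI JG x; rewrite {1}Ig => -[c ->].
  apply: (big_ind J) => [||i _]; [exact: ideal0|exact: idealD|].
  by apply: idealM => //; apply/JG/map_f; rewrite mem_enum.
have [G [GI GJ]] := N I II; exists (size G), (fun i => G`_i).
apply/seteqP; split=> [|x [c ->]].
  apply: GJ => [|g gG].
    split=> [|x y [c ->] [d ->]|a x [c ->]].
    - by exists (fun=> 0); rewrite big1 // => i _; rewrite mul0r.
    - exists (fun i => c i + d i); rewrite -big_split /=.
      by apply: eq_bigr => i _; rewrite mulrDl.
    - exists (fun i => a * c i); rewrite mulr_sumr.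
      by apply: eq_bigr => i _; rewrite mulrA.
  have gi : (index g G < size G)%N by rewrite index_mem.
  exists (fun k => (k == Ordinal gi)%:R).
  rewrite (bigD1 (Ordinal gi)) //= eqxx mul1r nth_index // big1 ?addr0 //.
  by move=> k /negbTE->; rewrite mul0r.
apply: (big_ind I) => [||i _]; [exact: ideal0|exact: idealD|].
by apply: idealM => //; apply/GI/mem_nth.
Qed.

Lemma noetherian_int : noetherian int.
Proof.
apply/noetherianP => I II.
have [[a [Ia a0]]|I0] := pselect (exists a, I a /\ a != 0); last first.
  exists [:: 0]; split=> [g|J JI J0 x Ix].
    by rewrite inE => /eqP->; apply: ideal0.
  have [->|x0] := eqVneq x 0; first exact: ideal0.
  by case: I0; exists x.
have ex : exists n, `[< (0 < n)%N /\ exists2 b : int, I b & `|b|%N = n >].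
  by exists `|a|%N; apply/asboolP; rewrite absz_gt0; split=> //; exists a.
have [n /asboolP[n0 [b Ib bn]] nmin] := ex_minnP ex.
exists [:: b]; split=> [g|J JI Jb x Ix]; first by rewrite inE => /eqP->.
have b0 : b != 0 by rewrite -absz_gt0 bn.
have lt : (absz (x %% b)%Z < n)%N.
  by rewrite -bn; have := ltz_mod x b0; have := modz_ge0 x b0; case: (x %% b)%Z.
have r0 : (x %% b)%Z = 0.
  apply/eqP/negP => /negP r0; move: lt; rewrite ltnNge nmin //.
  apply/asboolP; rewrite absz_gt0; split=> //; exists (x %% b)%Z => //.
  by rewrite /modz; apply: idealB => //; apply: idealM.
rewrite (divz_eq x b) r0 addr0; apply: idealM => //; apply: Jb.
by rewrite inE.
Qed.

Lemma noetherian_poly (R : comNzRingType) : noetherian R -> noetherian {poly R}.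
Proof.
move=> /noetherianP N; apply/noetherianP => I II.
(* the leading coefficients of the elements of degree n of J, and 0 *)
pose L (n : nat) (J : set {poly R}) : set R :=
  [set a | exists p, [/\ J p, (size p <= n.+1)%N & p`_n = a]].
have LI n J : is_ideal J -> is_ideal (L n J).
  move=> JI; split.
  - by exists 0; rewrite size_poly0 coef0; split=> //; apply: ideal0.
  - move=> _ _ [p [Jp sp <-]] [q [Jq sq <-]]; exists (p + q); rewrite coefD.
    by split=> //; [apply: idealD|rewrite (leq_trans (size_polyD _ _)) // geq_max sp].
  - move=> a _ [p [Jp sp <-]]; exists (a%:P * p); rewrite coefCM.
    by split=> //; [apply: idealM|rewrite mul_polyC (leq_trans (size_scale_leq _ _))].
(* Subtracting an element of both I and J with the same coefficient in degree n reduces p to smaller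
   size. *)
have step n J : is_ideal J -> (forall p, I p -> (size p <= n)%N -> J p) ->
    (L n I `<=` L n (I `&` J)) -> forall p, I p -> (size p <= n.+1)%N -> J p.
  move=> JI Jn LJ p Ip sp.
  have [|q [[Iq Jq] sq qp]] := LJ p`_n; first by exists p.
  rewrite -(subrK q p); apply: idealD => //; apply: Jn; first exact: idealB.
  apply/leq_sizeP => k; rewrite leq_eqVlt coefB => /orP[/eqP<-|nk].
    by rewrite qp subrr.
  by rewrite !nth_default ?subrr // (leq_trans _ nk).
have IJI J : is_ideal J -> is_ideal (I `&` J).
  move=> JI; split=> [|x y [? ?] [? ?]|a x [? ?]]; split;
    by [apply: ideal0|apply: idealD|apply: idealM].
(* Finitely many elements of I control all those of size at most n: at each stage, lifts of
   generators of [L n I] are added. *)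
have low n : exists G : seq {poly R}, (forall g, g \in G -> I g) /\
    forall J, is_ideal J -> (forall g, g \in G -> J g) ->
      forall p, I p -> (size p <= n)%N -> J p.
  elim: n => [|n [G [GI GJ]]].
    exists [::]; split=> // J JI _ p _; rewrite leqn0 size_poly_eq0 => /eqP->.
    exact: ideal0.
  have [H [HL HJ]] := N _ (LI n I II).
  have /choice[l lP] a : exists p, a \in H -> [/\ I p, (size p <= n.+1)%N & p`_n = a].
    have [/HL[p pP]|] := boolP (a \in H); first by exists p.
    by exists 0.
  exists (G ++ map l H); split=> [g|J JI JG].
    by rewrite mem_cat => /orP[/GI //|/mapP[a /lP[Ia _ _] ->]].
  apply: step => //.
    by apply: GJ => // g gG; apply: JG; rewrite mem_cat gG.
  apply: HJ; first exact/LI/IJI.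
  move=> a aH; have [Ia sa an] := lP a aH; exists (l a); split=> //; split=> //.
  by apply: JG; rewrite mem_cat map_f ?orbT.
pose M : set R := [set a | exists n, L n I a].
have up n m J : is_ideal J -> (n <= m)%N -> L n J `<=` L m J.
  move=> JI nm a [p [Jp sp pa]]; exists ('X^(m - n) * p); split.
  - exact: idealM.
  - have [->|p0] := eqVneq p 0; first by rewrite mulr0 size_poly0.
    have -> : m.+1 = (m - n + n.+1)%N by rewrite addnS subnK.
    by rewrite mulrC size_mulXn // leq_add2l.
  - by rewrite coefXnM ltnNge leq_subr /= subKn.
have MI : is_ideal M.
  split.
  - by exists 0%N; exact: ideal0 (LI 0%N I II).
  - move=> a b [n La] [m Lb]; exists (maxn n m); have IL := LI (maxn n m) I II.
    by apply: idealD => //; [apply: (up n)|apply: (up m)]; rewrite ?leq_maxl ?leq_maxr.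
  - by move=> a b [n Lb]; exists n; apply: idealM => //; apply: LI.
have [H [HM HJ]] := N _ MI.
have /choice[d dP] a : exists n, a \in H -> L n I a.
  have [/HM[n Ln]|] := boolP (a \in H); first by exists n.
  by exists 0%N.
(* All generators of M lie in [L m I], so the ideals of leading coefficients are constant from m on
   and [low m.+1] suffices. *)
pose m := \max_(a <- H) d a.
have [G [GI GJ]] := low m.+1; exists G; split=> // J JI JG p Ip.
have {}GJ := GJ J JI JG.
have main n : forall p, I p -> (size p <= m.+1 + n)%N -> J p.
  elim: n => [|n IH]; first by rewrite addn0.
  rewrite addnS; apply: step => // a La.
  have Ma : M a by exists (m.+1 + n)%N.
  apply: (HJ _ _ _ a Ma); first exact/LI/IJI.
  move=> b bH; apply: (up m); [exact: IJI|by rewrite addSn ltnW // ltnS leq_addr|].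
  have [q [Iq sq qb]] : L m I b.
    by apply: (up (d b)); [|rewrite /m; apply: leq_bigmax_seq|apply: dP].
  by exists q; split=> //; split=> //; apply: GJ.
by apply: (main (size p)) => //; apply: leq_addl.
Qed.

Lemma noetherian_ringquot (R : comPzRingType) (S : set R) :
  noetherian R -> noetherian (ringquot S).
Proof.
move=> /noetherianP N; apply/noetherianP => I II; pose f := ringquot_pi S.
have fI (J : set (ringquot S)) : is_ideal J -> is_ideal (f @^-1` J).
  move=> JI; split=> [|x y Jx Jy|a x Jx] /=; rewrite /f.
  - by rewrite rmorph0; apply: ideal0.
  - by rewrite rmorphD; apply: idealD.
  - by rewrite rmorphM; apply: idealM.
have [G [GI GJ]] := N _ (fI I II); exists (map f G); split.
  by move=> _ /mapP[g /GI Ig ->].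
move=> J JI JG x; rewrite -[x]ringquot_piK => Ix.
by apply: (GJ _ (fI J JI)) => // g gG; apply/JG/map_f.
Qed.

Lemma noetherian_exA : noetherian exA.
Proof.
exact/noetherian_ringquot/noetherian_poly/noetherian_poly/noetherian_int.
Qed.

(** * The spectrum *)

Section QuotientLift.
Variables (R T : comPzRingType) (S : set R) (f : {rmorphism R -> T}).
Hypothesis fS : forall r, S r -> f r = 0.

Definition ringquot_lift of (forall r, S r -> f r = 0) :=
  fun q : ringquot S => f (repr q).

Lemma ringquot_liftE r : ringquot_lift fS (ringquot_pi S r) = f r.
Proof.
apply/eqP; rewrite -subr_eq0 -rmorphB; apply/eqP.
have /ringquot_eq/ideal_genP h : ringquot_pi S (repr (ringquot_pi S r)) = ringquot_pi S r.
  exact: ringquot_piK.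
apply: (h [set a | f a = 0]) => //; split=> [|a b /= fa fb|a b /= fb].
- exact: rmorph0.
- by rewrite rmorphD fa fb addr0.
- by rewrite rmorphM fb mulr0.
Qed.

Let lift_zmod : zmod_morphism (ringquot_lift fS).
Proof.
move=> p q; rewrite -[p]ringquot_piK -[q]ringquot_piK.
by rewrite -(rmorphB (ringquot_pi S)) !ringquot_liftE rmorphB.
Qed.

Let lift_monoid : monoid_morphism (ringquot_lift fS).
Proof.
split=> [|p q]; first by rewrite -(rmorph1 (ringquot_pi S)) ringquot_liftE rmorph1.
rewrite -[p]ringquot_piK -[q]ringquot_piK.
by rewrite -(rmorphM (ringquot_pi S)) !ringquot_liftE rmorphM.
Qed.

HB.instance Definition _ :=
  GRing.isZmodMorphism.Build (ringquot S) T (ringquot_lift fS) lift_zmod.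
HB.instance Definition _ :=
  GRing.isMonoidMorphism.Build (ringquot S) T (ringquot_lift fS) lift_monoid.

End QuotientLift.

Lemma ker_prime (R : comPzRingType) (T : idomainType) (f : {rmorphism R -> T}) :
  is_prime [set a | f a = 0].
Proof.
split=> [||x y /=].
- split=> [|a b /= fa fb|a b /= fb]; first exact: rmorph0.
    by rewrite rmorphD fa fb addr0.
  by rewrite rmorphM fb mulr0.
- by rewrite /= rmorph1; apply/eqP/oner_neq0.
- by rewrite rmorphM => /eqP; rewrite mulf_eq0 => /orP[]/eqP; [left|right].
Qed.

#[local] Notation exrel := [set Zuw_u * (Zuw_u + 2%:R) * (1 - Zuw_u * Zuw_w) : Zuw].

Lemma exA_rel : exA_u * (exA_u + 2%:R) * (1 - exA_u * exA_w) = 0.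
Proof.
have -> : exA_u * (exA_u + 2%:R) * (1 - exA_u * exA_w) =
    ringquot_pi exrel (Zuw_u * (Zuw_u + 2%:R) * (1 - Zuw_u * Zuw_w)).
  by rewrite !(rmorphM, rmorphB, rmorphD, rmorph1).
by rewrite -(rmorph0 (ringquot_pi exrel)); apply/ringquot_eq; rewrite subr0; apply: ideal_gen_sub.
Qed.

Lemma ex_rel0 (T : comPzRingType) (f : {rmorphism Zuw -> T}) :
  [\/ f Zuw_u = 0, f Zuw_u + 2%:R = 0 | 1 - f Zuw_u * f Zuw_w = 0] ->
  f (Zuw_u * (Zuw_u + 2%:R) * (1 - Zuw_u * Zuw_w)) = 0.
Proof.
rewrite !rmorphM rmorphB rmorphD rmorphM rmorph1 rmorph_nat.
by case=> ->; rewrite ?mul0r ?mulr0 ?mul0r.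
Qed.

Section ExPrimes.
Variables (T : idomainType) (f : {rmorphism Zuw -> T}).
Hypothesis f0 : f (Zuw_u * (Zuw_u + 2%:R) * (1 - Zuw_u * Zuw_w)) = 0.

Let fS r : exrel r -> f r = 0. Proof. by move=> ->. Qed.

Definition ex_point : Spec exA :=
  exist _ _ (ker_prime (ringquot_lift fS : {rmorphism exA -> T})).

Lemma ex_pointE r : proj1_sig ex_point (ringquot_pi exrel r) <-> f r = 0.
Proof. by rewrite /ex_point /= ringquot_liftE. Qed.

End ExPrimes.

Definition eval_u (a : int) : {rmorphism Zuw -> {poly int}} := map_poly (horner_eval a).

Lemma eval_u_u a : eval_u a Zuw_u = a%:P.
Proof. by rewrite /eval_u /= /Zuw_u map_polyC /= /horner_eval hornerX. Qed.

Lemma eval_u_w a : eval_u a Zuw_w = 'X.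
Proof. exact: map_polyX. Qed.

(** As u is the inner variable, the factor theorem applies to each coefficient in w separately. *)
Lemma eval_u_ker a r : eval_u a r = 0 -> exists q, r = q * (Zuw_u - a%:P%:P).
Proof.
move=> /polyP ra.
have /choice[q qP] i : exists q, r`_i = q * ('X - a%:P).
  apply/factor_theorem/rootP; have := ra i.
  by rewrite coef0 [in LHS]coef_map.
exists (\poly_(i < size r) q i); apply/polyP => i.
rewrite -polyCB coefMC coef_poly; case: ltnP => // le.
by rewrite nth_default // mul0r.
Qed.

Definition eval_inv : {rmorphism Zuw -> {fraction {poly int}}} :=
  horner_eval (tofrac 'X)^-1 \o map_poly (@tofrac {poly int}).

Lemma eval_invC c : eval_inv c%:P = tofrac c.
Proof. by rewrite /eval_inv /= map_polyC /= /horner_eval hornerC. Qed.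

Lemma eval_inv_w : eval_inv Zuw_w = (tofrac 'X)^-1.
Proof. by rewrite /eval_inv /= map_polyX /horner_eval hornerX. Qed.

Lemma tofracX_neq0 : tofrac 'X != 0 :> {fraction {poly int}}.
Proof. by rewrite tofrac_eq0 polyX_eq0. Qed.

Lemma eval_inv_rel : eval_inv (1 - Zuw_u * Zuw_w) = 0.
Proof.
by rewrite rmorphB rmorph1 rmorphM eval_invC eval_inv_w mulfV ?subrr // tofracX_neq0.
Qed.

(** The power of u clears the denominators introduced by w = 1/u. It can be cancelled modulo any
    prime containing 1 - u w, since u is a unit there. *)
Lemma eval_inv_ker r : eval_inv r = 0 ->
  exists n q, Zuw_u ^+ n * r = q * (1 - Zuw_u * Zuw_w).
Proof.
have [n [q [c e]]] : exists n q c,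
    Zuw_u ^+ n * r = q * (1 - Zuw_u * Zuw_w) + c%:P.
  elim/poly_ind: r => [|r c [n [q [d e]]]].
    by exists 0%N, 0, 0; rewrite polyC0; ring.
  (* From u w d = d - d (1 - u w). *)
  exists n.+1, (Zuw_u * Zuw_w * q - d%:P), (d + 'X ^+ n.+1 * c).
  rewrite polyCD polyCM polyC_exp -/Zuw_u -[X in r * X]/Zuw_w.
  transitivity (Zuw_u * Zuw_w * (Zuw_u ^+ n * r) + Zuw_u ^+ n.+1 * c%:P).
    by rewrite exprS; ring.
  by rewrite e; ring.
move=> r0; exists n, q; rewrite e.
have := congr1 eval_inv e; rewrite rmorphD !rmorphM eval_inv_rel r0 !mulr0 add0r.
rewrite eval_invC => /esym/eqP; rewrite tofrac_eq0 => /eqP->.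
by rewrite polyC0 addr0.
Qed.

Definition eval_mod (p : nat) (a b : int) : {rmorphism Zuw -> 'F_p} :=
  intr \o horner_eval b \o eval_u a.

Lemma eval_modE p a b :
  (eval_mod p a b Zuw_u = a%:~R) * (eval_mod p a b Zuw_w = b%:~R).
Proof.
by rewrite /eval_mod /= -[map_poly _ _]/(eval_u a _) -[map_poly _ _]/(eval_u a _)
  eval_u_u eval_u_w /horner_eval hornerC hornerX.
Qed.

(* V(u), V(u + 2) and V(1 - u w) are the closures of the points P0, P2 and Pi; the
   first two meet at S2 (over F_2, u = w = 0), the last two at S3 (over F_3, u = w = 1). *)
Lemma Spec_exA_connected : connected [set: Spec exA].
Proof.
have r0 : eval_u 0 (Zuw_u * (Zuw_u + 2%:R) * (1 - Zuw_u * Zuw_w)) = 0.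
  by apply: ex_rel0; constructor 1; rewrite eval_u_u.
have r2 : eval_u (- 2%:R) (Zuw_u * (Zuw_u + 2%:R) * (1 - Zuw_u * Zuw_w)) = 0.
  by apply: ex_rel0; constructor 2; rewrite eval_u_u polyCN -[2%:R in X in _ + X]polyC_natr // polyC_natr addNr.
have ri : eval_inv (Zuw_u * (Zuw_u + 2%:R) * (1 - Zuw_u * Zuw_w)) = 0.
  by rewrite rmorphM eval_inv_rel mulr0.
have s2 : eval_mod 2 0 0 (Zuw_u * (Zuw_u + 2%:R) * (1 - Zuw_u * Zuw_w)) = 0.
  by apply: ex_rel0; constructor 1; rewrite eval_modE.
have s3 : eval_mod 3 1 1 (Zuw_u * (Zuw_u + 2%:R) * (1 - Zuw_u * Zuw_w)) = 0.
  by apply: ex_rel0; constructor 2; rewrite eval_modE; apply/eqP.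
pose P0 := ex_point r0; pose P2 := ex_point r2; pose Pi := ex_point ri.
pose S2 := ex_point s2; pose S3 := ex_point s3.
have piP (P : Spec exA) q r : proj1_sig P (ringquot_pi exrel r) ->
    proj1_sig P (ringquot_pi exrel (q * r)).
  by move=> Pr; rewrite rmorphM; have [[_ _ M] _ _] := proj2_sig P; apply: M.
have sub0 (P : Spec exA) : proj1_sig P exA_u -> proj1_sig P0 `<=` proj1_sig P.
  move=> Pu x; rewrite -[x]ringquot_piK => /ex_pointE/eval_u_ker[q ->].
  by apply: piP; rewrite polyC0 subr0.
have sub2 (P : Spec exA) :
    proj1_sig P (exA_u + 2%:R) -> proj1_sig P2 `<=` proj1_sig P.
  move=> Pu x; rewrite -[x]ringquot_piK => /ex_pointE/eval_u_ker[q ->].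
  by apply: piP; rewrite !polyCN opprK !polyC_natr rmorphD rmorph_nat.
have subi (P : Spec exA) :
    proj1_sig P (1 - exA_u * exA_w) -> proj1_sig Pi `<=` proj1_sig P.
  move=> Pu x; rewrite -[x]ringquot_piK => /ex_pointE/eval_inv_ker[n [q e]].
  have [[_ PD PM] P1 Pp] := proj2_sig P.
  have : proj1_sig P (ringquot_pi exrel (Zuw_u ^+ n * repr x)).
    by rewrite e; apply: piP; rewrite rmorphB rmorphM rmorph1.
  have nPu : ~ proj1_sig P exA_u.
    move=> h; apply: P1; rewrite -(subrK (exA_u * exA_w) 1); apply: PD => //.
    by rewrite mulrC; apply: PM.
  rewrite rmorphM rmorphXn; elim: n {e} => [|n IH]; first by rewrite mul1r.
  by rewrite exprS -mulrA => /Pp[].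
have cover (P : Spec exA) : [\/ proj1_sig P exA_u, proj1_sig P (exA_u + 2%:R)
    | proj1_sig P (1 - exA_u * exA_w)].
  have [[P0' _ _] _ Pp] := proj2_sig P.
  have : proj1_sig P (exA_u * (exA_u + 2%:R) * (1 - exA_u * exA_w)) by rewrite exA_rel.
  by move=> /Pp[/Pp[]|] h; [constructor 1|constructor 2|constructor 3].
have pu (T : idomainType) (f : {rmorphism Zuw -> T})
    (h : f (Zuw_u * (Zuw_u + 2%:R) * (1 - Zuw_u * Zuw_w)) = 0) :
    (f Zuw_u = 0 -> proj1_sig (ex_point h) exA_u) /\
    (f Zuw_u + 2%:R = 0 -> proj1_sig (ex_point h) (exA_u + 2%:R)) /\
    (1 - f Zuw_u * f Zuw_w = 0 -> proj1_sig (ex_point h) (1 - exA_u * exA_w)).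
  split; first by move=> fu; apply/ex_pointE.
  split=> fu.
    have -> : exA_u + 2%:R = ringquot_pi exrel (Zuw_u + 2%:R) by rewrite rmorphD rmorph_nat.
    by apply/ex_pointE; rewrite rmorphD rmorph_nat.
  have -> : 1 - exA_u * exA_w = ringquot_pi exrel (1 - Zuw_u * Zuw_w).
    by rewrite rmorphB rmorphM rmorph1.
  by apply/ex_pointE; rewrite rmorphB rmorphM rmorph1.
have S2u : proj1_sig S2 exA_u by apply: (pu _ _ s2).1; rewrite eval_modE.
have S2v : proj1_sig S2 (exA_u + 2%:R).
  by apply: (pu _ _ s2).2.1; rewrite eval_modE; apply/eqP.
have S3v : proj1_sig S3 (exA_u + 2%:R).
  by apply: (pu _ _ s3).2.1; rewrite eval_modE; apply/eqP.
have S3i : proj1_sig S3 (1 - exA_u * exA_w).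
  by apply: (pu _ _ s3).2.2; rewrite !eval_modE; apply/eqP.
move=> B [b Bb] [U [E UE] BU] [V cV BV].
have [F VF] : exists F, V = zariski_closed F.
  have : open (~` V) by rewrite openC.
  by move=> [F /(congr1 setC)]; rewrite !setCK; exists F.
(* A closed set is stable under specialisation and an open one under generisation, so membership in
   B is constant along inclusions of primes. *)
have clB (P P' : Spec exA) : proj1_sig P `<=` proj1_sig P' -> B P -> B P'.
  by move=> PP'; rewrite BV VF => -[_ FP]; split=> // x /FP/PP'.
have clBc (P P' : Spec exA) : proj1_sig P `<=` proj1_sig P' -> B P' -> B P.
  move=> PP'; rewrite BU UE => -[_ EP']; split=> // EP.
  by apply: EP' => x /EP/PP'.
have B0S : B P0 <-> B S2 by split; [apply: clB|apply: clBc]; apply: sub0.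
have B2S : B P2 <-> B S2 by split; [apply: clB|apply: clBc]; apply: sub2.
have B2T : B P2 <-> B S3 by split; [apply: clB|apply: clBc]; apply: sub2.
have BiT : B Pi <-> B S3 by split; [apply: clB|apply: clBc]; apply: subi.
have toP2 P : B P <-> B P2.
  case: (cover P) => h.
  - rewrite B2S -B0S; split; [apply: clBc|apply: clB]; exact: sub0.
  - split; [apply: clBc|apply: clB]; exact: sub2.
  - rewrite B2T -BiT; split; [apply: clBc|apply: clB]; exact: subi.
by apply/seteqP; split=> // P _; apply/toP2/(toP2 b).
Qed.

Lemma Spec_exA_nonempty : [set: Spec exA] !=set0.
Proof.
have r0 : eval_u 0 (Zuw_u * (Zuw_u + 2%:R) * (1 - Zuw_u * Zuw_w)) = 0.
  by rewrite !rmorphM eval_u_u polyC0 !mul0r.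
by exists (ex_point r0).
Qed.

(** * The homomorphism from MU^{Z/2} *)

(** The law is affine in each variable, so only the powers 0 and 1 of F enter the composites; the
    second composite reduces to the first by symmetry. *)
Lemma mult_law_fgl (R : comPzRingType) (v : R) : is_fgl (mult_law v).
Proof.
set F := mult_law v.
have F0 i : F i 0 = (i == 1)%:R by case: i => [|[]].
have F1 i : F i 1 = (i == 0)%:R + (i == 1)%:R * v.
  by case: i => [|[|i]]; rewrite /= ?mul0r ?mul1r ?addr0 ?add0r.
have F2 i k : F i k.+2 = 0 by case: i => [|[]].
have Fs i j : F i j = F j i by case: i j => [|[|i]] [|[|j]].
have e1 i j : ser2_exp F 1 i j = F i j.
  rewrite /= /ser2_mul big_ord_recr big1 /= ?add0r => [|[p /= p_lt] _].
    rewrite big_ord_recr big1 /= ?add0r => [|[q /= q_lt] _].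
      by rewrite !subnn /ser2_one mulr1.
    by rewrite /ser2_one (subn_eq0 j) leqNgt q_lt andbF mulr0.
  by rewrite big1 // => q _; rewrite /ser2_one (subn_eq0 i) leqNgt p_lt mulr0.
have asl i j k : fgl_assocl F i j k =
    F 0%N k * ((i == 0) && (j == 0))%:R + F 1%N k * F i j.
  rewrite /fgl_assocl; have [/eqP|] := posnP (i + j).
    rewrite addn_eq0 => /andP[/eqP-> /eqP->].
    by rewrite big_ord_recl big_ord0 /= !addr0 mulr0 addr0.
  case: (i + j)%N => // n _; rewrite 2!big_ord_recl big1 => [|p _].
    by rewrite addr0; congr (_ + _ * _); apply: e1.
  by rewrite !lift0 Fs F2 mul0r.
have asr i j k : fgl_assocr F i j k =
    F i 0%N * ((j == 0) && (k == 0))%:R + F i 1%N * F j k.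
  rewrite ![F i _]Fs -asl /fgl_assocl /fgl_assocr.
  by apply: eq_bigr => p _; rewrite Fs.
split=> // i j k; rewrite asl asr.
by case: i => [|[|i]]; case: j => [|[|j]]; case: k => [|[|k]];
  rewrite /F /=; ring.
Qed.

Lemma fgl_two_mult_law (R : comPzRingType) (v : R) k :
  fgl_two (mult_law v) k = match k with 1 => 2%:R | 2 => v | _ => 0 end.
Proof.
case: k => [|[|[|k]]]; rewrite /fgl_two ?big_ord_recl ?big_ord0 /= ?addr0 ?add0r //.
rewrite big1 ?addr0 ?add0r //= => i _; by rewrite !lift0.
Qed.

(** For the uniqueness of the homomorphism this is applied twice: over the integers for the Lazard
    ring, and over [MU] for the equivariant ring. *)
Lemma malg_hom_eq (V : choiceType) (R : comNzRingType) (S : pzRingType)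
    (f g : {rmorphism {malg R[{cmonom V}]} -> S}) :
  (forall c, f (malgC c) = g (malgC c)) ->
  (forall v, f << ucm v >> = g << ucm v >>) -> f =1 g.
Proof.
move=> fgC fgX.
have mulE (c d : R) (k l : {cmonom V}) :
    << c *g k >> * << d *g l >> = << (c * d) *g (mmul k l) >> :> {malg R[{cmonom V}]}.
  by rewrite malgM_def fgmulUU.
have mon (m : {cmonom V}) : f << m >> = g << m >>.
  have [n] := ubnP (mdeg m); elim: n m => // n IH m; rewrite ltnS => le.
  have [->|m1] := eqVneq m mone; first exact: fgC.
  have [v vm] : exists v, m v != 0%N.
    apply: contrapT => h; case/eqP: m1; apply/eqP/cmP => v; rewrite cm1.
    by apply/eqP/negP => /negP vm; apply: h; exists v.
  have mE : m = mmul (ucm v) (divcm m (ucm v)).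
    apply/eqP/cmP => i; rewrite cmM cmU divcmE cmU.
    by case: eqP => [<-|_]; rewrite ?subn0 // subnKC // lt0n.
  have -> : << m >> = << ucm v >> * << divcm m (ucm v) >> :> {malg R[{cmonom V}]}.
    by rewrite mulE mulr1 -mE.
  apply: etrans (rmorphM f _ _) (etrans _ (esym (rmorphM g _ _))).
  congr (_ * _); first exact: fgX.
  by apply: IH; move: le; rewrite {1}mE mdegM mdegU.
move=> p; rewrite [p]monalgE !rmorph_sum; apply: eq_bigr => m _.
have -> : << p@_m *g m >> = malgC (p@_m) * << m >> :> {malg R[{cmonom V}]}.
  by rewrite mulE mulr1 mul1m.
apply: etrans (rmorphM f _ _) (etrans _ (esym (rmorphM g _ _))).
by congr (_ * _).
Qed.

Definition eval_11 : {rmorphism Zuw -> int} := horner_eval 1 \o eval_u 1.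

Lemma eval_11_rel r : exrel r -> eval_11 r = 0.
Proof.
move=> ->; have w1 : eval_11 Zuw_w = 1.
  by rewrite /eval_11 /= -[map_poly _ _]/(eval_u 1 _) eval_u_w /horner_eval hornerX.
have u1 : eval_11 Zuw_u = 1.
  by rewrite /eval_11 /= -[map_poly _ _]/(eval_u 1 _) eval_u_u /horner_eval hornerC.
by apply: ex_rel0; constructor 3; rewrite u1 w1.
Qed.

Definition exA_to_int : {rmorphism exA -> int} := ringquot_lift eval_11_rel.

Lemma exA_to_int_u : exA_to_int exA_u = 1.
Proof.
by rewrite [LHS]ringquot_liftE /eval_11 /= -[map_poly _ _]/(eval_u 1 _) eval_u_u
  /horner_eval hornerC.
Qed.

Lemma exA_to_int_w : exA_to_int exA_w = 1.
Proof.
by rewrite [LHS]ringquot_liftE /eval_11 /= -[map_poly _ _]/(eval_u 1 _) eval_u_w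
  /horner_eval hornerX.
Qed.

Lemma exA_neq0 : (1 : exA) != 0.
Proof.
by apply/eqP => /(congr1 exA_to_int); rewrite rmorph1 rmorph0 => /eqP; rewrite oner_eq0.
Qed.

HB.instance Definition _ := GRing.PzSemiRing_isNonZero.Build exA exA_neq0.

Definition exA_j : exA := exA_u * (exA_u + 2%:R).

Lemma exA_u2 : exA_u ^+ 2 = exA_j - 2%:R * exA_u.
Proof. by rewrite /exA_j; ring. Qed.

Lemma exA_juw : exA_j * exA_u * exA_w = exA_j.
Proof.
apply/esym/eqP; rewrite -subr_eq0; apply/eqP; rewrite -exA_rel /exA_j; ring.
Qed.

Lemma exA_jw_neq0 n : exA_j * exA_w ^+ n != 0.
Proof.
apply/eqP => /(congr1 exA_to_int).
rewrite /exA_j !rmorphM rmorphXn rmorphD rmorph_nat exA_to_int_u exA_to_int_w.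
by rewrite expr1n rmorph0.
Qed.

Definition lazard_mult : {rmorphism lazard_poly -> exA} :=
  poly_eval (intr : {rmorphism int -> exA})
    (fun ij : nat * nat => mult_law 1 ij.1 ij.2).

Lemma lazard_multX i j : lazard_mult (lazard_var i j) = mult_law 1 i j.
Proof. exact: poly_evalX. Qed.

Lemma lazard_mult_rel r : lazard_rel r -> lazard_mult r = 0.
Proof.
have [H0 HC HA] := mult_law_fgl (1 : exA).
case=> [[i ->]|[i [j ->]]|[i [j [k ->]]]]; apply: etrans (rmorphB lazard_mult _ _) _;
  apply/eqP; rewrite subr_eq0; apply/eqP.
- exact: etrans (lazard_multX _ _) (etrans (H0 i) (esym (rmorph_nat lazard_mult _))).
- exact: etrans (lazard_multX _ _) (etrans (HC i j) (esym (lazard_multX _ _))).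
- apply: etrans (rmorph_fgl_assocl lazard_multX i j k) _.
  exact: etrans (HA i j k) (esym (rmorph_fgl_assocr lazard_multX i j k)).
Qed.

Definition MU_mult : {rmorphism MU -> exA} := ringquot_lift lazard_mult_rel.

Lemma MU_mult_pi r : MU_mult (ringquot_pi lazard_rel r) = lazard_mult r.
Proof. exact: ringquot_liftE. Qed.

Lemma MU_mult_a i j : MU_mult (MU_a i j) = mult_law 1 i j.
Proof. exact: etrans (MU_mult_pi _) (lazard_multX i j). Qed.

Lemma rmorph_fgl_two (R S : comPzRingType) (f : {rmorphism R -> S}) (F : ser2 R)
    (G : ser2 S) k : (forall i j, f (F i j) = G i j) ->
  f (fgl_two F k) = fgl_two G k.
Proof. by move=> FG; rewrite rmorph_sum; apply: eq_bigr => i _. Qed.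

Local Notation exq := (coef_q exA_u exA_w exA_j).
Local Notation exb := (coef_b exA_u).

Lemma exq0 : exq 0 = 0.
Proof. by rewrite /coef_q mulr1 subrr. Qed.

(** The part - j w^k is stable because j u w = j; the rest is j = u (2 + u), 2 + u = 2 + u and 1 = 1
    for k = 0, 1, 2. *)
Lemma exq_rec k : exq k = fgl_two (mult_law 1) k + exA_u * exq k.+1.
Proof.
have e : exA_j * exA_w ^+ k = exA_u * (exA_j * exA_w ^+ k.+1).
  by rewrite -{1}exA_juw exprS; ring.
rewrite fgl_two_mult_law /coef_q e; case: k {e} => [|[|[|k]]]; rewrite ?/exA_j; ring.
Qed.

Lemma exb_rec i k : (1 <= i)%N -> exb i k = mult_law 1 i k + exA_u * exb i k.+1.
Proof. by case: i => [//|[|i]]; case: k => [|[|k]] _; rewrite /=; ring. Qed.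

Definition muz2_ex : {rmorphism muz2_poly -> exA} :=
  poly_eval MU_mult (fun g => match g with
    | Gu => exA_u | Gq k => exq k | Gb i k => exb i.+1 k end).

Lemma muz2_exC a : muz2_ex (muz2_const a) = MU_mult a.
Proof. by rewrite /muz2_ex /= /poly_eval mmapU mmorph1 mulr1. Qed.

Lemma muz2_ex_q k : muz2_ex (muz2_q k) = exq k.
Proof. exact: poly_evalX. Qed.

Lemma muz2_ex_u : muz2_ex muz2_u = exA_u.
Proof. exact: poly_evalX. Qed.

Lemma muz2_ex_b i k : (1 <= i)%N -> muz2_ex (muz2_b i k) = exb i k.
Proof. by case: i => // i _; exact: poly_evalX. Qed.

Lemma muz2_ex_rel r : muz2_rel r -> muz2_ex r = 0.
Proof.
case=> [->|[i ->]|[i [k [i1 ->]]]].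
- by apply: etrans (muz2_ex_q 0) exq0.
- apply: etrans (rmorphB muz2_ex _ _) _.
  have -> : muz2_ex (muz2_q i - muz2_const (MU_c i)) = exq i - fgl_two (mult_law 1) i.
    apply: etrans (rmorphB muz2_ex _ _) _; congr (_ - _); first exact: muz2_ex_q.
    apply: etrans (muz2_exC _) _; apply: rmorph_fgl_two; exact: MU_mult_a.
  have -> : muz2_ex (muz2_u * muz2_q i.+1) = exA_u * exq i.+1.
    apply: etrans (rmorphM muz2_ex _ _) _.
    by congr (_ * _); [exact: muz2_ex_u|exact: muz2_ex_q].
  by rewrite exq_rec; ring.
- apply: etrans (rmorphB muz2_ex _ _) _.
  have -> : muz2_ex (muz2_b i k - muz2_const (MU_a i k)) = exb i k - mult_law 1 i k.
    apply: etrans (rmorphB muz2_ex _ _) _; congr (_ - _); first exact: muz2_ex_b.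
    exact: etrans (muz2_exC _) (MU_mult_a _ _).
  have -> : muz2_ex (muz2_u * muz2_b i k.+1) = exA_u * exb i k.+1.
    apply: etrans (rmorphM muz2_ex _ _) _.
    by congr (_ * _); [exact: muz2_ex_u|exact: muz2_ex_b].
  by rewrite (exb_rec k i1); ring.
Qed.

Definition ex_phi : {rmorphism MUZ2 -> exA} := ringquot_lift muz2_ex_rel.

Lemma ex_phi_pi r : ex_phi (ringquot_pi muz2_rel r) = muz2_ex r.
Proof. exact: ringquot_liftE. Qed.

Lemma ex_phi_a i k : ex_phi (MUZ2_a i k) = mult_law 1 i k.
Proof.
exact: etrans (ex_phi_pi _) (etrans (muz2_exC _) (MU_mult_a i k)).
Qed.

Lemma ex_phi_u : ex_phi MUZ2_u = exA_u.
Proof. exact: etrans (ex_phi_pi _) muz2_ex_u. Qed.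

Lemma ex_phi_q k : ex_phi (MUZ2_q k) = exq k.
Proof. exact: etrans (ex_phi_pi _) (muz2_ex_q k). Qed.

Lemma ex_phi_b i k : (1 <= i)%N -> ex_phi (MUZ2_b i k) = exb i k.
Proof. by move=> i1; exact: etrans (ex_phi_pi _) (muz2_ex_b k i1). Qed.

Lemma ex_phi_hom : ex_hom ex_phi.
Proof.
split=> [||||k k3].
- exact: ex_phi_u.
- by split=> [|i k]; rewrite ex_phi_a //; case: i k => [|[|i]] [|[|k]].
- exact: ex_phi_b.
- by move=> i k i1 ik; rewrite ex_phi_b //; case: i k i1 ik => [|[|i]] [|[|k]].
- by rewrite ex_phi_q /coef_q /exA_j; case: k k3 => [|[|[|k]]] // _; ring.
Qed.

(** * Uniqueness of the homomorphism *)

Section Restriction.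
Variable phi : {rmorphism MUZ2 -> exA}.
Let psi : {rmorphism muz2_poly -> exA} := phi \o ringquot_pi muz2_rel.

Lemma muz2_rel_eq p q v r : muz2_rel (p - q - v * r) ->
  psi p = psi q + psi v * psi r.
Proof.
move=> rel; have : psi (p - q - v * r) = 0.
  rewrite -(rmorph0 phi); apply: (congr1 phi).
  rewrite -(rmorph0 (ringquot_pi muz2_rel)); apply/ringquot_eq.
  by rewrite subr0; apply: ideal_gen_sub.
have -> : psi (p - q - v * r) = psi p - psi q - psi v * psi r.
  apply: etrans (rmorphB psi _ _) _; congr (_ - _); first exact: rmorphB.
  exact: rmorphM.
by move=> /eqP; rewrite subr_eq0 subr_eq => /eqP ->; rewrite addrC.
Qed.

Let chi : {rmorphism MU -> exA} := psi \o (malgC : {rmorphism MU -> muz2_poly}).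

Lemma MUZ2_q_rec F k : (forall i j, phi (MUZ2_a i j) = F i j) ->
  phi (MUZ2_q k) = fgl_two F k + phi MUZ2_u * phi (MUZ2_q k.+1).
Proof.
move=> phia; rewrite -(rmorph_fgl_two (f := chi) k phia).
by apply: muz2_rel_eq; constructor 2; exists k.
Qed.

Lemma MUZ2_b_rec i k : (1 <= i)%N ->
  phi (MUZ2_b i k) = phi (MUZ2_a i k) + phi MUZ2_u * phi (MUZ2_b i k.+1).
Proof. by move=> i1; apply: muz2_rel_eq; constructor 3; exists i, k. Qed.

Lemma MUZ2_a0 i : phi (MUZ2_a i 0) = (i == 1)%:R.
Proof.
rewrite -(rmorph_nat chi); apply: (congr1 chi).
rewrite -(rmorph_nat (ringquot_pi lazard_rel)); apply/ringquot_eq.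
by apply: ideal_gen_sub; constructor 1; exists i.
Qed.

Lemma MUZ2_aC i k : phi (MUZ2_a i k) = phi (MUZ2_a k i).
Proof.
apply: (congr1 chi); apply/ringquot_eq.
by apply: ideal_gen_sub; constructor 2; exists i, k.
Qed.

End Restriction.

(** The values that are not prescribed come from the relations: a_{i0} and a_{01} from those of the
    Lazard ring, b_{10} from b_{11}, and q_2, q_1, q_0 by descent from q_3. *)
Lemma ex_hom_values (phi : {rmorphism MUZ2 -> exA}) : ex_hom phi ->
  [/\ phi MUZ2_u = exA_u, forall i k, phi (MUZ2_a i k) = mult_law 1 i k,
      forall i k, (1 <= i)%N -> phi (MUZ2_b i k) = exb i k
    & forall k, phi (MUZ2_q k) = exq k].
Proof.
case=> phiu [a11 a0] b11 b0 q3.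
have phia i k : phi (MUZ2_a i k) = mult_law 1 i k.
  case: k i => [|[|k]] i; first by rewrite [LHS](MUZ2_a0 phi i); case: i => [|[]].
    case: i => [|[|i]]; first exact: etrans (MUZ2_aC phi 0 1) (MUZ2_a0 phi 1).
      exact: a11.
    exact: (a0 i.+2 1).
  rewrite [LHS](a0 i k.+2); last exact: orbT.
  by case: i => [|[]].
split; [exact: phiu|exact: phia|move=> i k i1|move=> k].
  case: i i1 => [|[|i]] i1; first exact: (False_ind _ (notF i1)); last first.
    exact: b0.
  case: k => [|[|k]]; last exact: (b0 1%N k.+2).
    apply: etrans (@MUZ2_b_rec phi 1 0 isT) (etrans _ (esym (@exb_rec 1 0 isT))).
    exact: (f_equal2 +%R (phia 1%N 0%N) (f_equal2 *%R phiu b11)).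
  exact: b11.
have qS n : phi (MUZ2_q n.+1) = exq n.+1 -> phi (MUZ2_q n) = exq n.
  move=> IH; apply: etrans (MUZ2_q_rec n phia) (etrans _ (esym (exq_rec n))).
  exact: (f_equal2 +%R erefl (f_equal2 *%R phiu IH)).
have q3' n : phi (MUZ2_q n.+3) = exq n.+3.
  by apply: etrans (q3 n.+3 isT) _; rewrite /coef_q /exA_j; ring.
by case: k => [|[|[|k]]]; [apply/qS/qS/qS|apply/qS/qS|apply: qS|]; apply: q3'.
Qed.

Lemma ex_hom_uniq (phi phi' : {rmorphism MUZ2 -> exA}) :
  ex_hom phi -> ex_hom phi' -> phi' =1 phi.
Proof.
move=> /ex_hom_values[u1 a1 b1 q1] /ex_hom_values[u2 a2 b2 q2] x.
rewrite -[x]ringquot_piK; move: (repr x) => p {x}.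
apply: (malg_hom_eq (f := phi' \o ringquot_pi muz2_rel)
                    (g := phi \o ringquot_pi muz2_rel)) => [c|[|k|i k]].
- rewrite -[c]ringquot_piK; move: (repr c) => r {c}.
  pose chi (f : {rmorphism MUZ2 -> exA}) : {rmorphism lazard_poly -> exA} :=
    f \o ringquot_pi muz2_rel \o (malgC : {rmorphism MU -> muz2_poly})
      \o ringquot_pi lazard_rel.
  apply: (malg_hom_eq (f := chi phi') (g := chi phi)) => [n|[i k]].
    have nE : malgC n = n%:~R :> lazard_poly.
      have := rmorph_int (malgC : {rmorphism int -> lazard_poly}) n.
      by rewrite intz.
    by rewrite nE !rmorph_int.
  exact: etrans (a2 i k) (esym (a1 i k)).
- exact: etrans u2 (esym u1).
- exact: etrans (q2 k) (esym (q1 k)).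
- exact: etrans (b2 i.+1 k isT) (esym (b1 i.+1 k isT)).
Qed.

(** Here [2]x = 2 x + v x^2. Its third remainder does not see v, so it obstructs multiplicativity
    for all v at once. *)
Lemma efgl_multiplicative_rem3 (A : comPzRingType) (E : efgl A) :
  efgl_multiplicative E -> efgl_theta E true (efgl_rem 3 (efgl_two_x E)) = 0.
Proof.
move=> [v psix]; set EE := hopf_ten2 E; set x := efgl_x E.
set m := ctt_copair EE (cth_id E) (cth_id E).
have m1 : m (ctt_in1 EE x) = x by exact: ctt_copair1.
have m2 : m (ctt_in2 EE x) = x by exact: ctt_copair2.
(* In Horner form, three uses of [efgl_remS] strip the coefficients 0, 2, v and leave 0. *)
have two : efgl_two_x E =
    ct_unit E 0 + x * (ct_unit E 2%:R + x * (ct_unit E v + x * 0)).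
  transitivity (m (ctt_in1 EE x) + m (ctt_in2 EE x) +
      m (ct_unit EE v) * (m (ctt_in1 EE x) * m (ctt_in2 EE x))).
    by rewrite /efgl_two_x psix !rmorphD !rmorphM.
  by rewrite m1 m2 cth_unit; ring.
by rewrite two !efgl_remS efgl_rem0 rmorph0.
Qed.

Theorem mainTheorem6 :
  [/\ noetherian exA,
      [set: Spec exA] !=set0 /\ connected [set: Spec exA] &
      exists phi : {rmorphism MUZ2 -> exA},
        [/\ ex_hom phi,
            forall phi' : {rmorphism MUZ2 -> exA}, ex_hom phi' -> phi' =1 phi,
            exists E : efgl exA, efgl_classified phi E &
            forall E : efgl exA, efgl_classified phi E ->
              ~ efgl_multiplicative E /\
              exists F : nat -> nat -> exA,
                [/\ is_fgl F, efgl_underlying E F &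
                    exists v : exA, forall i j, F i j = mult_law v i j]]].
Proof.
have phiF : (fun i k => ex_phi (MUZ2_a i k)) = mult_law 1.
  by apply/funext => i; apply/funext => k; exact: ex_phi_a.
split; first exact: noetherian_exA.
  by split; [exact: Spec_exA_nonempty|exact: Spec_exA_connected].
exists ex_phi; split; first exact: ex_phi_hom.
- by move=> phi' h; exact: ex_hom_uniq ex_phi_hom h.
- exists (bc_efgl exA_u2 exA_juw); split.
  + by rewrite phiF; exact: bc_efgl_underlying.
  + by rewrite [LHS]ex_phi_u bc_efgl_euler.
  + exists (mult_coef (efgl_x (bc_efgl exA_u2 exA_juw))).
      exact: bc_efgl_expansion.
    by move=> i k i1; rewrite bc_efgl_b //; exact: ex_phi_b.
  + by move=> k; rewrite bc_efgl_q; exact: ex_phi_q.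
(* For an arbitrary E classified by the homomorphism, the values a_{ij} give the underlying law and
   q_3 = - j w^3 excludes multiplicativity; the constructed model is not consulted. *)
- move=> E [und _ _ two]; split.
    move=> /efgl_multiplicative_rem3; rewrite -two [LHS]ex_phi_q /coef_q sub0r.
    by move=> /eqP; rewrite oppr_eq0 (negbTE (exA_jw_neq0 3)).
  exists (mult_law 1); split; [exact: mult_law_fgl|by rewrite -phiF|].
  by exists 1.
Qed.
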